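(* Let $\pi\propto e^{-V}$ be a probability measure on $\mathbb{R}^d$, let $q\in(1,\infty)$, $q'\in[1,\infty]$, and suppose $\pi(\|\cdot\|^{2q/(q-1)}):=\int\|x\|^{2q/(q-1)}\,\mathrm{d}\pi(x)<\infty$. Suppose that for some $\alpha\in[0,2]$ and $b>0$, $$\|\nabla V(x)\|\le\frac{b\|x\|}{(1+\|x\|^2)^{1-\alpha/2}}\qquad\forall x\in\mathbb{R}^d,$$ and let $\nu:=b-d$. Then there are a constant $c_{b,\alpha}>0$ depending only on $b$ and $\alpha$, and a threshold $\Delta_*$ (depending on $\pi,q,b,\alpha,d$) such that for all $\Delta_0\ge\Delta_*$ the following lower bounds hold on the iteration complexity of LMC and on the time complexity of the Langevin diffusion for reaching accuracy $1$ in $q$-Rényi divergence: - if $\alpha=2$: $\ \mathscr{C}^{\mathrm{LMC}}_{R_q,\mathsf{KL}}(\pi,h,\Delta_0,1)\ge c_{b,\alpha}\,\dfrac{\ln(\Delta_0)}{h}$ for all $0<h<b^{-1}$, and $\ \mathscr{C}^{\mathrm{LD}}_{R_q,\mathsf{KL}}(\pi,\Delta_0,1)\ge c_{b,\alpha}\ln(\Delta_0)$; - if $\alpha\in(0,2)$: $\ \mathscr{C}^{\mathrm{LMC}}_{R_q,R_{q'}}(\pi,h,\Delta_0,1)\ge c_{b,\alpha}\,\dfrac{d^{1-\alpha/2}\Delta_0^{\frac{(2-\alpha)^2}{2\alpha}}}{h}$ for all $h>0$, and $\ \mathscr{C}^{\mathrm{LD}}_{R_q,R_{q'}}(\pi,\Delta_0,1)\ge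 c_{b,\alpha}\,d^{1-\alpha/2}\Delta_0^{\frac{(2-\alpha)^2}{2\alpha}}$; - if $\alpha=0$: $\ \mathscr{C}^{\mathrm{LMC}}_{R_q,R_{q'}}(\pi,h,\Delta_0,1)\ge c_{b,\alpha}\,\dfrac{d}{\nu h}\exp(\Delta_0/\nu)$ for all $h>0$, and $\ \mathscr{C}^{\mathrm{LD}}_{R_q,R_{q'}}(\pi,\Delta_0,1)\ge c_{b,\alpha}\,\dfrac{d}{\nu}\exp(\Delta_0/\nu)$.
   Context: Langevin diffusion: $\mathrm{d}X_t=-\nabla V(X_t)\,\mathrm{d}t+\sqrt2\,\mathrm{d}B_t$ with $B$ a standard $d$-dimensional Brownian motion, $\rho_t$ the law of $X_t$. Langevin Monte Carlo (LMC) with step size $h>0$: $x_{k+1}=x_k-h\nabla V(x_k)+\sqrt{2h}\,\xi_k$, with $(\xi_k)$ i.i.d. standard Gaussian vectors independent of $x_0$, $\mu_k$ the law of $x_k$. Complexities: for two divergences $\mathcal{D},\mathcal{D}'$, $\mathscr{C}^{\mathrm{LMC}}_{\mathcal{D},\mathcal{D}'}(\pi,h,\Delta_0,\varepsilon)$ is the smallest $k\in\mathbb{N}$ such that for any $\mu_0$ with $\mathcal{D}'(\mu_0\,\|\,\pi)\le\Delta_0$, LMC with step size $h$ satisfies $\mathcal{D}(\mu_k\,\|\,\pi)\le\varepsilon$. $\mathscr{C}^{\mathrm{LD}}_{\mathcal{D},\mathcal{D}'}(\pi,\Delta_0,\varepsilon)$ is the smallest $T\in\mathbb{R}_+$ such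 that for any $\rho_0$ with $\mathcal{D}'(\rho_0\,\|\,\pi)\le\Delta_0$, the Langevin diffusion satisfies $\mathcal{D}(\rho_T\,\|\,\pi)\le\varepsilon$. Rényi divergence: for $1<q<\infty$, $R_q(\rho\,\|\,\pi)=\frac1{q-1}\ln\big\|\frac{\mathrm{d}\rho}{\mathrm{d}\pi}\big\|_{L^q(\pi)}^q$ if $\rho\ll\pi$ and $+\infty$ otherwise; $R_1=\mathsf{KL}$; $R_\infty(\rho\,\|\,\pi)=\ln\|\mathrm{d}\rho/\mathrm{d}\pi\|_{L^\infty(\pi)}$. *)

(* Defs.v *)
From HB Require Import structures.
From mathcomp Require Import all_boot all_order all_algebra.
From mathcomp Require Import all_classical all_reals all_analysis.

Set Implicit Arguments.
Unset Strict Implicit.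
Unset Printing Implicit Defensive.

Import Order.TTheory GRing.Theory Num.Theory.
Import numFieldNormedType.Exports.

Local Open Scope classical_set_scope.
Local Open Scope ring_scope.

(* Borel sigma-algebra of R^d, generated by the coordinate maps. *)

Definition measure_rV_display : measure_display -> measure_display.
Proof. exact. Qed.

Section measurable_rV.
Context {R : realType} (d : nat).

Let coord : 'I_d -> 'rV[R]_d -> R := fun i x => x 0 i.

Let rV_set0 : g_sigma_preimage coord set0.
Proof. exact: sigma_algebra0. Qed.

Let rV_setC A : g_sigma_preimage coord A -> g_sigma_preimage coord (~` A).
Proof. exact: sigma_algebraC. Qed.

Let rV_bigcup (F : _^nat) : (forall i, g_sigma_preimage coord (F i)) ->
  g_sigma_preimage coord (\bigcup_i (F i)).
Proof. exact: sigma_algebra_bigcup. Qed.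

HB.instance Definition _ := @isMeasurable.Build
  (measure_rV_display default_measure_display)
  'rV[R]_d (g_sigma_preimage coord) rV_set0 rV_setC rV_bigcup.

End measurable_rV.

Section measurable_rV_theory.
Context {R : realType}.

Lemma measurable_rV_coord d (i : 'I_d) :
  measurable_fun [set: 'rV[R]_d] (fun x : 'rV[R]_d => x 0 i).
Proof.
move=> _ Y mY; rewrite setTI; apply: sub_sigma_algebra => /=.
rewrite -bigcup_seq/=; exists i => /=; first by rewrite mem_index_enum.
by exists Y => //; rewrite setTI.
Qed.

Lemma measurable_fun_rVP d' (T : measurableType d') d (f : T -> 'rV[R]_d) :
  measurable_fun [set: T] f <->
  forall i, measurable_fun [set: T] (fun t => f t 0 i).
Proof.
split=> [mf i|mf].
  exact: (measurableT_comp (measurable_rV_coord i) mf).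
move=> _ A mA; rewrite setTI.
suff : preimage_set_system [set: T] f measurable `<=` measurable.
  by apply; exists A => //; rewrite setTI.
rewrite -[X in preimage_set_system _ _ X]/(g_sigma_preimage _).
rewrite -g_sigma_preimage_comp.
apply: smallest_sub; first exact: sigma_algebra_measurable.
move=> B; rewrite -bigcup_seq/= => -[i _ [C mC <-]].
by rewrite setTI; have := mf i measurableT C mC; rewrite setTI.
Qed.

Definition rV_cons d (z : R * 'rV[R]_d) : 'rV[R]_d.+1 :=
  \row_i (if unlift ord0 i is Some j then z.2 0 j else z.1).

Definition rV_uncons d (x : 'rV[R]_d.+1) : R * 'rV[R]_d :=
  (x 0 ord0, \row_i x 0 (lift ord0 i)).

Lemma rV_consE0 d (z : R * 'rV[R]_d) : rV_cons z 0 ord0 = z.1.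
Proof. by rewrite mxE unlift_none. Qed.

Lemma rV_consES d (z : R * 'rV[R]_d) i : rV_cons z 0 (lift ord0 i) = z.2 0 i.
Proof. by rewrite mxE liftK. Qed.

Lemma rV_consK d : cancel (@rV_cons d) (@rV_uncons d).
Proof.
move=> [t x]; rewrite /rV_uncons rV_consE0; congr pair.
by apply/rowP => i; rewrite mxE rV_consES.
Qed.

Lemma rV_unconsK d : cancel (@rV_uncons d) (@rV_cons d).
Proof.
move=> x; apply/rowP => i; case: (unliftP ord0 i) => [j|] ->; last first.
  by rewrite rV_consE0.
by rewrite rV_consES mxE.
Qed.

Lemma measurable_rV_cons d : measurable_fun setT (@rV_cons d).
Proof.
apply/measurable_fun_rVP => i.
case: (unliftP ord0 i) => [j|] ->; last first.
  by under eq_fun do rewrite rV_consE0; exact: measurable_fst.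
under eq_fun do rewrite rV_consES.
exact: (measurableT_comp (measurable_rV_coord j) measurable_snd).
Qed.

Lemma measurable_rV_uncons d : measurable_fun setT (@rV_uncons d).
Proof.
apply/measurable_fun_pairP; split; first exact: measurable_rV_coord.
apply/measurable_fun_rVP => i.
under eq_fun do rewrite /= mxE.
exact: measurable_rV_coord.
Qed.

End measurable_rV_theory.

(* d-dimensional Lebesgue measure, as an iterated product *)

Section lebesgue_rV.
Context {R : realType}.
Local Open Scope ereal_scope.

Section lebesgue_cons.
Context (d : nat) (m : {sigma_finite_measure set 'rV[R]_d -> \bar R}).

Definition lebesgue_cons : set 'rV[R]_d.+1 -> \bar R :=
  pushforward (lebesgue_measure \x m) (@rV_cons R d).

Let lebesgue_cons0 : lebesgue_cons set0 = 0.
Proof. by rewrite /lebesgue_cons /pushforward preimage_set0 measure0. Qed.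

Let lebesgue_cons_ge0 A : 0 <= lebesgue_cons A.
Proof. by rewrite /lebesgue_cons /pushforward measure_ge0. Qed.

Let lebesgue_cons_sigma_additive : semi_sigma_additive lebesgue_cons.
Proof.
move=> F mF tF mUF; rewrite /lebesgue_cons /pushforward preimage_bigcup.
apply: measure_semi_sigma_additive.
- by move=> n; rewrite -[X in measurable X]setTI; exact: measurable_rV_cons.
- apply/trivIsetP => /= i j _ _ ij; rewrite -preimage_setI.
  by move/trivIsetP : tF => /(_ _ _ _ _ ij) ->//; rewrite preimage_set0.
- rewrite -preimage_bigcup -[X in measurable X]setTI.
  exact: measurable_rV_cons.
Qed.

HB.instance Definition _ := isMeasure.Build _ _ _ lebesgue_cons
  lebesgue_cons0 lebesgue_cons_ge0 lebesgue_cons_sigma_additive.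

Let lebesgue_cons_sigma_finite : sigma_finite setT lebesgue_cons.
Proof.
have /sigma_finiteP[G [TG ndG Goo]] := sigma_finiteT (@lebesgue_measure R).
have /sigma_finiteP[H [TH ndH Hoo]] := sigma_finiteT m.
pose F n := G n `*` H n.
have TF : [set: R * 'rV[R]_d] = \bigcup_n F n.
  rewrite -setXTT [in LHS]TG TH predeqE => -[x y]; split.
    move=> [/= [n _ Gnx] [k _ Hky]]; exists (maxn n k) => //; split.
    - by move: x Gnx; exact/subsetPset/ndG/leq_maxl.
    - by move: y Hky; exact/subsetPset/ndH/leq_maxr.
  by move=> [n _ []/= ? ?]; split; exists n.
have Foo n : measurable (F n) /\ (lebesgue_measure \x m) (F n) < +oo.
  have [? ?] := Goo n; have [? ?] := Hoo n.
  split; first exact: measurableX.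
  by rewrite product_measure1E// lte_mul_pinfty// ge0_fin_numE.
exists (fun i => @rV_uncons R d @^-1` F i).
  by rewrite -preimage_bigcup -TF preimage_setT.
move=> i; have [mFi Fioo] := Foo i; split.
  by rewrite -[X in measurable X]setTI; exact: measurable_rV_uncons.
rewrite /lebesgue_cons /pushforward -comp_preimage.
rewrite (_ : _ \o _ = id); last by apply/funext => z /=; rewrite rV_consK.
by rewrite preimage_id.
Qed.

HB.instance Definition _ := Measure_isSigmaFinite.Build _ _ _ lebesgue_cons
  lebesgue_cons_sigma_finite.

End lebesgue_cons.

Fixpoint lebesgue_rV (d : nat) : {sigma_finite_measure set 'rV[R]_d -> \bar R} :=
  match d with
  | 0%N => \d_(0%R : 'rV[R]_0)
  | d'.+1 => lebesgue_cons (lebesgue_rV d')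
  end.

End lebesgue_rV.

Section euclidean.
Context {R : realType} {d : nat}.

(* The norm `|x| of the library on 'rV[R]_d is the sup norm. *)
Definition enorm (x : 'rV[R]_d) : R := Num.sqrt (\sum_(i < d) x 0 i ^+ 2).

Definition grad (V : 'rV[R]_d -> R) (x : 'rV[R]_d) : 'rV[R]_d :=
  \row_(i < d) 'D_(delta_mx 0 i) V x.

Definition gibbs (V : 'rV[R]_d -> R) (pi : probability 'rV[R]_d R) : Prop :=
  exists2 c : R, 0 < c & forall A, measurable A ->
    pi A = (c%:E * \int[lebesgue_rV d]_(x in A) (expR (- V x))%:E)%E.

End euclidean.

Section divergences.
Context {R : realType} {disp : measure_display} {T : measurableType disp}.
Local Open Scope ereal_scope.
Local Open Scope charge_scope.
Implicit Types rho pi : probability T R.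

Definition density rho pi : T -> \bar R :=
  'd (charge_of_finite_measure rho) '/d pi.

Definition KL rho pi : \bar R :=
  if `[< rho `<< pi >] then \int[rho]_x lne (density rho pi x) else +oo.

(* The order q ranges over [1, +oo]; the value at q = -oo is irrelevant. *)
Definition renyi (q : \bar R) rho pi : \bar R :=
  if `[< rho `<< pi >] then
    match q with
    | r%:E => if r == 1%R then KL rho pi
              else ((r - 1)^-1)%:E * lne ('N[pi]_(r%:E)[density rho pi] `^ r)
    | +oo => lne ('N[pi]_(+oo)[density rho pi])
    | -oo => 0
    end
  else +oo.

End divergences.

Section processes.
Context {R : realType} {d : nat}.
Context {disp : measure_display} {T : measurableType disp}.
Variable P : probability T R.

Definition has_law (X : T -> 'rV[R]_d) (mu : probability 'rV[R]_d R) : Prop :=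
  measurable_fun setT X /\
  forall A, measurable A -> P (X @^-1` A) = mu A.

Definition mutually_independent (I : eqType) (disp' : measure_display)
    (S : measurableType disp') (X : I -> T -> S) : Prop :=
  forall (J : seq I) (A : I -> set S), uniq J ->
    (forall i, measurable (A i)) ->
    P (\bigcap_(i in [set` J]) X i @^-1` A i) =
    (\prod_(i <- J) P (X i @^-1` A i))%E.

(* Z has the centred Gaussian law with covariance s^2 times the identity. *)
Definition isotropic_gaussian (s : R) (Z : T -> 'rV[R]_d) : Prop :=
  [/\ measurable_fun setT Z,
      mutually_independent (fun (i : 'I_d) (w : T) => Z w 0 i) &
      forall (i : 'I_d) (A : set R), measurable A ->
        P [set w | A (Z w 0 i)] = normal_prob 0 s A].

Definition lmc_chain (V : 'rV[R]_d -> R) (h : R)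
    (x xi : nat -> T -> 'rV[R]_d) : Prop :=
  [/\ measurable_fun setT (x 0%N),
      forall k, isotropic_gaussian 1 (xi k),
      (* x_0, xi_0, xi_1, ... are mutually independent *)
      mutually_independent (fun o : option nat =>
        if o is Some k then xi k else x 0%N) &
      forall k w, x k.+1 w =
        x k w - h *: grad V (x k w) + Num.sqrt (2 * h) *: xi k w].

(* Time is the half-line [0, +oo[; only indices t >= 0 are constrained. *)
Definition filtration (F : R -> set (set T)) : Prop :=
  [/\ forall t, 0 <= t -> sigma_algebra setT (F t),
      forall t, 0 <= t -> F t `<=` measurable &
      forall s t, 0 <= s -> s <= t -> F s `<=` F t].

Definition adapted (F : R -> set (set T)) (X : R -> T -> 'rV[R]_d) : Prop :=
  forall t, 0 <= t -> forall A, measurable A -> F t (X t @^-1` A).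

Definition brownian_motion (F : R -> set (set T))
    (B : R -> T -> 'rV[R]_d) : Prop :=
  [/\ adapted F B,
      {ae P, forall w, B 0 w = 0},
      {ae P, forall w, {within `[0, +oo[, continuous (fun t : R => B t w)}},
      forall s t, 0 <= s -> s < t ->
        isotropic_gaussian (Num.sqrt (t - s)) (fun w => B t w - B s w) &
      forall s t, 0 <= s -> s < t -> forall C A, F s C -> measurable A ->
        P (C `&` [set w | A (B t w - B s w)]) =
        (P C * P [set w | A (B t w - B s w)%R])%E].

(* Solution of dX_t = - grad V (X_t) dt + sqrt 2 dB_t. The noise is additive,
   so the stochastic integral of the constant sqrt 2 is sqrt 2 * B_t and the
   equation is the integral equation below, coordinate by coordinate. *)
Definition langevin_solution (V : 'rV[R]_d -> R) (F : R -> set (set T))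
    (B X : R -> T -> 'rV[R]_d) : Prop :=
  [/\ filtration F,
      brownian_motion F B,
      adapted F X,
      {ae P, forall w, {within `[0, +oo[, continuous (fun t : R => X t w)}} &
      {ae P, forall w, forall t : R, 0 <= t -> forall i : 'I_d,
        lebesgue_measure.-integrable `[0, t]
          (fun s : R => (grad V (X s w) 0 i)%:E) /\
        X t w 0 i = X 0 w 0 i
          - \int[lebesgue_measure]_(s in `[0, t]) grad V (X s w) 0 i
          + Num.sqrt 2 * B t w 0 i}].

End processes.

Section complexity.
Context {R : realType} {d : nat}.
Implicit Types (V : 'rV[R]_d -> R) (mu rho pi : probability 'rV[R]_d R).

(* muk is the law of x_k for LMC started from mu0. *)
Definition lmc_law V (h : R) mu0 (k : nat) muk : Prop :=
  exists (disp : measure_display) (T : measurableType disp)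
         (P : probability T R) (x xi : nat -> T -> 'rV[R]_d),
    [/\ lmc_chain P V h x xi, has_law P (x 0%N) mu0 & has_law P (x k) muk].

(* rhot is the law of X_t for a (weak) solution started from rho0. *)
Definition langevin_law V rho0 (t : R) rhot : Prop :=
  exists (disp : measure_display) (T : measurableType disp)
         (P : probability T R) (F : R -> set (set T))
         (B X : R -> T -> 'rV[R]_d),
    [/\ langevin_solution P V F B X, has_law P (X 0) rho0
      & has_law P (X t) rhot].

Definition divergence := probability 'rV[R]_d R -> probability 'rV[R]_d R ->
  \bar R.

(* Complexities are infima in \bar R, hence +oo when no k (resp. T) works.
   "The" law of x_k (resp. X_T) given the initial law is referred to through
   the existence of a realization; for differentiable V with grad V of linear
   growth, realizations exist and their law is unique. *)
Definition lmc_complexity (D D' : divergence) V pi (h Delta0 eps : R) : \bar R :=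
  ereal_inf [set (k%:R)%:E | k in [set k : nat |
    forall mu0, (D' mu0 pi <= Delta0%:E)%E ->
      exists2 muk, lmc_law V h mu0 k muk & (D muk pi <= eps%:E)%E]].

Definition langevin_complexity (D D' : divergence) V pi (Delta0 eps : R) :
    \bar R :=
  ereal_inf [set T%:E | T in [set T : R | 0 <= T /\
    forall rho0, (D' rho0 pi <= Delta0%:E)%E ->
      exists2 rhoT, langevin_law V rho0 T rhoT & (D rhoT pi <= eps%:E)%E]].

End complexity.

(* Main.v *)
Require Import Defs.
From HB Require Import structures.
From mathcomp Require Import all_boot all_order all_algebra.
From mathcomp Require Import all_classical all_reals all_analysis.
From mathcomp Require Import measurable_realfun ess_sup_inf.
From mathcomp Require Import ring lra.

Set Implicit Arguments.
Unset Strict Implicit.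
Unset Printing Implicit Defensive.

Import Order.TTheory GRing.Theory Num.Theory.
Import numFieldNormedType.Exports.

Local Open Scope classical_set_scope.
Local Open Scope ring_scope.

(** Let [box r] be the cube [r, 2r]^d. The gradient bound integrates to
    [V x <= V 0 + W |x|] with [W] explicit, hence to a lower bound on
    [pi (box r)]: [-ln (pi (box r))] is at most [K r^alpha + C] if [alpha > 0]
    and at most [nu ln r + C] if [alpha = 0].

    For [alpha < 2] start from [pi] conditioned on [box r]: all its Renyi
    divergences are at most [-ln (pi (box r))], which is made equal to [Delta0]
    by the choice of [r]. As long as the process stays at distance of order [r]
    from the origin its drift is [O(r^(alpha - 1))], and by Kolmogorov's maximal
    inequality its noise up to time [tau] is [O(sqrt tau)]; so after a time
    [tau << r^(2 - alpha)] the process is still at distance [r / 2] with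
    probability at least 1/2. But [renyi q mu pi <= 1] and the moment assumption
    on [pi] force [mu {|x| >= r} = o(r^-2)]. The claimed bounds on [tau] are
    [o(r^(2 - alpha))] as [Delta0] grows, so the constant 1 is good enough.

    For [alpha = 2] the complexities are in fact infinite: moving a mass
    [w ~ r^-2] of [pi] to [box r] costs a bounded KL divergence uniformly in [r],
    while [k] steps (or a time [t]) contract norms by a fixed factor at most, up
    to bounded noise. For [r] large the mass left near distance [r] contradicts
    the [o(r^-2)] tail. *)

(** * Independent increments and Kolmogorov's maximal inequality *)

(** The order of the tail comes from cutting the density at a height [lam]: [renyi q mu pi <= 1]
    gives [mu A <= lam^(1-q) e^(q-1) + lam pi A]. With [lam] a multiple of [r^(2/(q-1))] and a
    finite moment of order [2q/(q-1)], both terms at distance [r] fall below any multiple of [r^-2].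
    For [alpha = 2] this beats the mass that a bounded KL budget can move to [box r], since
    [- ln (pi (box r))] is [O(r^2)]; for [alpha < 2] any decay would do.

    The room for the constant 1: if [0 < alpha < 2], [Delta0 ~ K r^alpha] makes [r^(2-alpha)] of
    order [Delta0^((2-alpha)/alpha)], which exceeds the claimed power by [Delta0^((2-alpha)/2)]; if
    [alpha = 0], it is [exp(2 Delta0/nu)] against [exp(Delta0/nu)]. The surplus swallows [b], [d]
    and the normalization of [pi], all allowed in the threshold.

    For [alpha < 2] the drift is controlled only while the process stays in a shell, so the path
    estimates are bootstraps: strong induction for the chain, a continuity argument for the
    diffusion. They are deterministic once the noise is bounded, hence apply to every realization
    over which the complexities quantify. *)

Section independent_product.
Context {R : realType} {disp : measure_display} {T : measurableType disp}.
Variable P : probability T R.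
Local Open Scope ereal_scope.

Lemma bounded_integrable (Y : T -> R) (M : R) : measurable_fun setT Y ->
  (forall w, `|Y w| <= M)%R -> P.-integrable setT (EFin \o Y).
Proof.
move=> mY YM; apply: measurable_bounded_integrable => //.
  by rewrite (le_lt_trans (probability_le1 _ _)) ?ltry.
exists M; split; first exact: num_real.
by move=> x Mx w _; rewrite /= (le_trans (YM w))// ltW.
Qed.

(** The joint law of [(Y, Z)] agrees with the product of the marginals on rectangles, hence
    everywhere, and Fubini factors the integral. Boundedness of [Y] makes the product integrable as
    soon as [Z] is. *)
Lemma integral_indep (Y Z : {mfun T >-> R}) (M : R) :
  (forall w, `|Y w| <= M)%R -> P.-integrable setT (EFin \o Z) ->
  (forall A B, measurable A -> measurable B ->
    P (Y @^-1` A `&` Z @^-1` B) = P (Y @^-1` A) * P (Z @^-1` B)) ->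
  \int[P]_w (Y w * Z w)%:E = (\int[P]_w (Y w)%:E) * (\int[P]_w (Z w)%:E).
Proof.
move=> YM iZ YZ.
have mpair : measurable_fun setT (fun w => (Y w, Z w)).
  exact/measurable_fun_pairP.
pose X :=
  mfun_Sub (mem_set mpair).
pose dX : {measure set _ -> \bar R} := distribution P X.
pose dY : probability _ R := distribution P Y.
pose dZ : probability _ R := distribution P Z.
have prodE : forall A, measurable A -> (dY \x dZ) A = dX A.
  apply: product_measure_unique => A B mA mB.
  by rewrite /dX /dY /dZ /distribution/= /pushforward/= -YZ.
pose f : R * R -> \bar R := EFin \o (fun z : R * R => z.1 * z.2)%R.
have mmul : measurable_fun setT f.
  by apply/measurable_EFinP; apply: measurable_funM.
have iYZ : P.-integrable setT (fun w => (Y w * Z w)%:E).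
  apply: (@integrableMr _ _ _ P setT measurableT Y (EFin \o Z)) => //.
  exists M; split; first exact: num_real.
  by move=> x Mx w _; rewrite /= (le_trans (YM w))// ltW.
have -> : \int[P]_w (Y w * Z w)%:E = \int[dX]_z f z.
  by rewrite [RHS]integral_distribution.
have iX : dX.-integrable setT f.
  by apply: integrable_pushforward => //.
have iXp : (dY \x dZ).-integrable setT f.
  move/integrableP : iX => [m1 i1]; apply/integrableP; split => //.
  by rewrite (eq_measure_integral dX)// => A mA _; exact: prodE.
rewrite -(@eq_measure_integral _ _ _ setT dX (dY \x dZ) f); last first.
  by move=> A mA _; exact: prodE.
rewrite -integral12_prod_meas1//=.
have iZd : dZ.-integrable setT EFin.
  by apply: integrable_pushforward => //.
have EZ : \int[dZ]_z z%:E = \int[P]_w (Z w)%:E.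
  by rewrite integral_distribution.
transitivity (\int[dY]_x (x%:E * \int[P]_w (Z w)%:E)).
  apply: eq_integral => x _; rewrite -EZ -integralZl//.
have fZ : \int[P]_w (Z w)%:E \is a fin_num by exact: integrable_fin_num.
rewrite -(fineK fZ) integralZr//.
  by rewrite integral_distribution//; exact: (bounded_integrable _ YM).
apply: integrable_pushforward => //.
exact: (bounded_integrable _ YM).
Qed.

End independent_product.

Section kolmogorov.
Context {R : realType} {disp : measure_display} {T : measurableType disp}.
Variable P : probability T R.
Variables (F : nat -> set (set T)) (W : nat -> T -> R) (C : set T).
Variables (lam s2 : R).
Hypothesis lam0 : 0 <= lam.
Hypothesis s20 : 0 <= s2.
Hypothesis Fsigma : forall j, sigma_algebra setT (F j).
Hypothesis Fmeas : forall j, F j `<=` measurable.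
Hypothesis Fincr : forall j, F j `<=` F j.+1.
Hypothesis FC : F 0%N C.
Hypothesis FW : forall j B, measurable B -> F j (W j @^-1` B).
Hypothesis W0 : forall w, W 0%N w = 0.

Let Delta j w := W j.+1 w - W j w.

Hypothesis indep : forall j D B, F j D -> measurable B ->
  P (D `&` Delta j @^-1` B) = (P D * P (Delta j @^-1` B))%E.
Hypothesis iDelta : forall j, P.-integrable setT (EFin \o Delta j).
Hypothesis iDelta2 : forall j, P.-integrable setT (fun w => (Delta j w ^+ 2)%:E).
Hypothesis mean0 : forall j, \int[P]_w Delta j w = 0.
Hypothesis var : forall j, \int[P]_w (Delta j w ^+ 2) <= s2.

Let E j := [set w | forall i, (i <= j)%N -> `|W i w| <= lam].

Let Fle i j : (i <= j)%N -> F i `<=` F j.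
Proof.
elim: j => [|j IH]; first by rewrite leqn0 => /eqP ->.
rewrite leq_eqVlt => /orP[/eqP -> //|]; rewrite ltnS => /IH ij.
by apply: subset_trans ij _; exact: Fincr.
Qed.

Let mFW j : measurable_fun [set: g_sigma_algebraType (F j)]
  (W j : g_sigma_algebraType (F j) -> R).
Proof.
by move=> _ B mB; rewrite setTI; apply: sub_sigma_algebra; exact: FW.
Qed.

Let FD j : F j (C `&` E j).
Proof.
(* [F j] equals the sigma-algebra it generates, so measurability with respect to [F j] can be proved
   on [g_sigma_algebraType (F j)]. *)
rewrite -(sigma_algebra_id (Fsigma j)).
have -> : C `&` E j = C `&` \bigcap_(i in [set i | (i <= j)%N])
    W i @^-1` `[-lam, lam]%classic.
  congr (_ `&` _); apply/seteqP; split => w /= h i /h/=.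
    by rewrite in_itv/= ler_norml.
  by rewrite in_itv/= ler_norml.
apply: (@measurableI _ (g_sigma_algebraType (F j))).
  by apply: sub_sigma_algebra; exact: Fle FC.
apply: (@bigcap_measurable _ (g_sigma_algebraType (F j))); first by exists 0%N.
by move=> i /= ij; apply: sub_sigma_algebra; apply: (Fle ij); exact: FW.
Qed.

Let mW j : measurable_fun setT (W j).
Proof. by move=> _ B mB; rewrite setTI; apply: (@Fmeas j); exact: FW. Qed.

Let mDelta j : measurable_fun setT (Delta j).
Proof. by apply: measurable_funB. Qed.

Let mC : measurable C. Proof. exact: Fmeas FC. Qed.
Let mCE j : measurable (C `&` E j). Proof. exact: Fmeas (FD j). Qed.
Let mCDE j : measurable (C `\` E j).
Proof.
rewrite (_ : _ `\` _ = C `\` (C `&` E j)); first exact: measurableD.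
by rewrite setDIr setDv set0U.
Qed.

(** Cutting the walk at its first exit makes it bounded by [lam]: integrability is then free and
    [integral_indep] applies against the increment. *)
Let Y j w : R := W j w * \1_(C `&` E j) w.

Let mY j : measurable_fun setT (Y j).
Proof. by apply: measurable_funM => //; exact: measurable_indic. Qed.

Let FY j B : measurable B -> F j (Y j @^-1` B).
Proof.
move=> mB; rewrite -(sigma_algebra_id (Fsigma j)).
have mDF : measurable (C `&` E j : set (g_sigma_algebraType (F j))).
  by apply: sub_sigma_algebra; exact: FD.
have : measurable_fun [set: g_sigma_algebraType (F j)]
    (Y j : g_sigma_algebraType (F j) -> R).
  by apply: measurable_funM => //; exact: measurable_indic.
by move=> /(_ measurableT B mB); rewrite setTI.
Qed.

Let Ylam j w : `|Y j w| <= lam.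
Proof.
rewrite /Y indicE; have [|_] := boolP (w \in _); last by rewrite mulr0 normr0.
by rewrite inE => -[_ /(_ j (leqnn _))]; rewrite mulr1.
Qed.

(* The expectation of [g j], i.e. E[W_j^2; C, no exit yet] + lam^2 P(C, exit),
   grows by at most [P C * s2] per step. *)
Let g j w : R := Y j w ^+ 2 + lam ^+ 2 * \1_(C `\` E j) w.

(** Before any exit this is the expansion of [W j.+1 ^+ 2]; after an exit [g] stays at [lam ^+ 2];
    at the exit itself [lam ^+ 2 <= W j.+1 ^+ 2], so the overshoot can be given up. *)
Let g_step j w : g j.+1 w <=
  g j w + (2 * (Y j w * Delta j w) + \1_(C `&` E j) w * Delta j w ^+ 2).
Proof.
rewrite /g /Y /Delta !indicE !in_setD !in_setI.
have [Cw|nCw] := pselect (C w); last first.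
  by rewrite (memNset nCw)/= !(mulr0, mul0r) expr0n/= !addr0.
rewrite (mem_set Cw)/=.
have [Ej1|nEj1] := pselect (E j.+1 w).
  have Ej : E j w by move=> i ij; apply: Ej1; exact: leqW.
  by rewrite (mem_set Ej1) (mem_set Ej)/=; lra.
rewrite (memNset nEj1)/=.
have [Ej|nEj] := pselect (E j w); last first.
  by rewrite (memNset nEj)/=; lra.
rewrite (mem_set Ej)/=.
have lamW : lam ^+ 2 <= W j.+1 w ^+ 2.
  rewrite -[leRHS]real_normK ?num_real// lerXn2r ?nnegrE//.
  rewrite leNgt; apply/negP => Wlam; apply: nEj1 => i.
  rewrite leq_eqVlt => /orP[/eqP ->|]; first exact: ltW.
  by rewrite ltnS; exact: Ej.
by lra.
Qed.

Let indic_le1 (A : set T) w : `|\1_A w| <= 1 :> R.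
Proof. by rewrite indicE; case: (_ \in _); rewrite ?normr1 ?normr0. Qed.

Let ig j : P.-integrable setT (EFin \o g j).
Proof.
apply: (@bounded_integrable _ _ _ P _ (lam ^+ 2 + lam ^+ 2)).
  apply: measurable_funD; first exact: measurable_funX.
  by apply: measurable_funM => //; exact: measurable_indic.
move=> w; rewrite (le_trans (ler_normD _ _))// lerD//.
  by rewrite normrX lerXn2r ?nnegrE.
by rewrite normrM normrX ger0_norm// ler_piMr ?exprn_ge0.
Qed.

Let iYD j : P.-integrable setT (fun w => (Y j w * Delta j w)%:E).
Proof.
apply: (@integrableMr _ _ _ P setT measurableT (Y j) (EFin \o Delta j)) => //.
exists lam; split; first exact: num_real.
by move=> x lx w _; rewrite /= (le_trans (Ylam j w))// ltW.
Qed.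

Let i1D j : P.-integrable setT (fun w => (\1_(C `&` E j) w * Delta j w ^+ 2)%:E).
Proof.
apply: (@integrableMr _ _ _ P setT measurableT (\1_(C `&` E j) : T -> R)
  (fun w => (Delta j w ^+ 2)%:E)) => //.
exists 1; split; first exact: num_real.
by move=> x lx w _; rewrite /= (le_trans (indic_le1 _ w))// ltW.
Qed.

(** The cross term vanishes because [Y j] is [F j]-measurable, hence independent of the centred
    increment. *)
Let EYD j : \int[P]_w (Y j w * Delta j w) = 0.
Proof.
rewrite /Rintegral.
have := @integral_indep _ _ _ P (mfun_Sub (mem_set (mY j)))
  (mfun_Sub (mem_set (mDelta j))) lam (Ylam j) (iDelta j).
rewrite /= => ->; last first.
  by move=> A B mA mB; apply: indep => //; exact: FY.
rewrite fineM; [by rewrite -/(Rintegral P setT (Delta j)) mean0 mulr0| |].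
  by apply: integrable_fin_num => //; exact: (bounded_integrable P (mY j) (Ylam j)).
by apply: integrable_fin_num => //; exact: iDelta.
Qed.

Let E1D j : \int[P]_w (\1_(C `&` E j) w * Delta j w ^+ 2) <= fine (P C) * s2.
Proof.
rewrite /Rintegral.
have mD2 : measurable_fun setT (fun w => Delta j w ^+ 2).
  exact: measurable_funX.
have mI : measurable_fun setT (\1_(C `&` E j) : T -> R).
  exact: measurable_indic.
have := @integral_indep _ _ _ P (mfun_Sub (mem_set mI))
  (mfun_Sub (mem_set mD2)) 1 (indic_le1 _) (iDelta2 j).
rewrite /= => ->; last first.
  move=> A B mA mB.
  rewrite (_ : (fun w => Delta j w ^+ 2) @^-1` B =
    Delta j @^-1` ((fun x : R => x ^+ 2) @^-1` B)) //.
  apply: indep; last first.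
    rewrite -[X in measurable X]setTI.
    exact: (measurable_funX 2 (@measurable_id _ R setT)).
  rewrite -(sigma_algebra_id (Fsigma j)).
  have mDF : measurable (C `&` E j : set (g_sigma_algebraType (F j))).
    by apply: sub_sigma_algebra; exact: FD.
  have := @measurable_indic _ (g_sigma_algebraType (F j)) R setT _ mDF.
  by move=> /(_ measurableT A mA); rewrite setTI.
rewrite integral_indic// setIT fineM ?fin_num_measure//; last first.
  exact: integrable_fin_num.
rewrite ler_pM ?fine_ge0//; last exact: var.
  by apply: integral_ge0 => w _; rewrite lee_fin sqr_ge0.
by rewrite fine_le ?fin_num_measure// le_measure ?inE//; exact: subIsetl.
Qed.

Let a_step j : \int[P]_w g j.+1 w <= \int[P]_w g j w + fine (P C) * s2.
Proof.
have i2 : P.-integrable setT (EFin \o (fun w => 2 * (Y j w * Delta j w))).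
  exact: (@integrableZl _ _ _ P setT measurableT 2 _ (iYD j)).
have i3 : P.-integrable setT (EFin \o (fun w => 2 * (Y j w * Delta j w) +
    \1_(C `&` E j) w * Delta j w ^+ 2)).
  exact: (integrableD measurableT i2 (i1D j)).
have i4 : P.-integrable setT (EFin \o (fun w => g j w + (2 * (Y j w * Delta j w) +
    \1_(C `&` E j) w * Delta j w ^+ 2))).
  exact: (integrableD measurableT (ig j) i3).
apply: (le_trans (le_Rintegral measurableT (ig j.+1) i4 (fun w _ => g_step j w))).
rewrite (RintegralD measurableT (ig j) i3) lerD2l.
rewrite (RintegralD measurableT i2 (i1D j)) (RintegralZl 2 measurableT (iYD j)).
rewrite EYD mulr0 add0r.
exact: E1D.
Qed.

(** The mean of [g] starts at 0 as the walk does, grows by at most [P C * s2] per step, and [g n]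
    dominates [lam ^+ 2] on [C] minus [E n]. The event [C], known at time 0, will record that the
    process starts in a box. *)
Lemma kolmogorov n : ((lam ^+ 2)%:E * P (C `\` E n) <=
  P C * (n%:R * s2)%:E)%E.
Proof.
have a0 : \int[P]_w g 0 w = 0.
  have g0 w : g 0%N w = 0.
    rewrite /g /Y W0 mul0r expr0n/= add0r indicE memNset ?mulr0// => -[_] /=.
    by apply => i; rewrite leqn0 => /eqP ->; rewrite W0 normr0.
  rewrite /Rintegral; under eq_integral do rewrite g0.
  by rewrite integral0.
have an : \int[P]_w g n w <= fine (P C) * (n%:R * s2).
  elim: n => [|n IH]; first by rewrite a0 mul0r mulr0.
  rewrite (le_trans (a_step n))//.
  rewrite -natr1 mulrDl mul1r mulrDr lerD2r//.
have i1 : P.-integrable setT (EFin \o (\1_(C `\` E n) : T -> R)).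
  by apply: (bounded_integrable P _ (indic_le1 _)); exact: measurable_indic.
have : lam ^+ 2 * fine (P (C `\` E n)) <= \int[P]_w g n w.
  have -> : lam ^+ 2 * fine (P (C `\` E n)) =
      \int[P]_w (lam ^+ 2 * \1_(C `\` E n) w).
    rewrite (RintegralZl _ measurableT i1).
    by rewrite /Rintegral integral_indic// setIT.
  apply: le_Rintegral => //.
    exact: (@integrableZl _ _ _ P setT measurableT (lam ^+ 2) _ i1).
  by move=> w _; rewrite /g lerDr sqr_ge0.
move=> /le_trans/(_ an).
by rewrite -lee_fin !EFinM !fineK ?fin_num_measure.
Qed.

End kolmogorov.

(** * Densities and moments of the centred Gaussian law *)

Section density.
Context {R : realType} {disp : measure_display} {T : measurableType disp}.
Local Open Scope ereal_scope.

(** [g] and the Radon-Nikodym derivative have the same integral over every measurable set, so they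
    agree almost everywhere, and the change of variables for the derivative passes to [g]. *)
Lemma ge0_integral_density (nu : {finite_measure set T -> \bar R})
    (mu : {sigma_finite_measure set T -> \bar R}) (g f : T -> \bar R) :
  mu.-integrable setT g -> (forall x, 0 <= g x) ->
  (forall A, measurable A -> nu A = \int[mu]_(x in A) g x) ->
  measurable_fun setT f -> (forall x, 0 <= f x) ->
  \int[nu]_x f x = \int[mu]_x (f x * g x).
Proof.
move=> ig g0 nuE mf f0.
have numu : nu `<< mu.
  apply/null_content_dominatesP => A mA muA0; rewrite nuE//.
  apply: null_set_integral => //.
  by apply: measurable_funTS; exact: measurable_int ig.
rewrite -(Radon_Nikodym_SigmaFinite.change_of_variables numu)//.
have mRN := measurable_int _ (Radon_Nikodym_SigmaFinite.f_integrable numu).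
have mg := measurable_int _ ig.
apply: ge0_ae_eq_integral => //.
- exact: emeasurable_funM.
- exact: emeasurable_funM.
- by move=> x _; rewrite mule_ge0// Radon_Nikodym_SigmaFinite.f_ge0.
- by move=> x _; rewrite mule_ge0.
- apply: ae_eqe_mul2l.
  apply: integral_ae_eq => //.
    exact: Radon_Nikodym_SigmaFinite.f_integrable.
  by move=> A _ mA; rewrite -nuE// -Radon_Nikodym_SigmaFinite.f_integral.
Qed.

End density.

Section normal_moments.
Context {R : realType} {disp : measure_display} {T : measurableType disp}.
Variables (P : probability T R) (s : R) (Z : T -> R).
Hypothesis s0 : 0 < s.
Hypothesis mZ : measurable_fun setT Z.
Hypothesis lawZ : forall A, measurable A -> P [set w | A (Z w)] = normal_prob 0 s A.

Let N : probability (measurableTypeR R) R := normal_prob 0 s.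

Let integralZ (f : R -> \bar R) : measurable_fun setT f -> (forall x, 0 <= f x)%E ->
  (\int[P]_w f (Z w) = \int[N]_x f x)%E.
Proof.
move=> mf f0.
have mZ' : @measurable_fun _ _ T (measurableTypeR R) setT Z by exact: mZ.
have := @ge0_integral_distribution _ _ _ (measurableTypeR R) _ P
  (@mfun_Sub _ _ T (measurableTypeR R) Z (mem_set mZ')) f mf f0.
rewrite /= => <-.
by apply: eq_measure_integral => A mA _; exact: lawZ.
Qed.

(* [x^2 / s^2 <= 4 exp (x^2 / (4 s^2))] trades the second moment for the mass
   of a centred Gaussian of variance [2 s^2]. *)
Let normal_pdf_sqr x :
  x ^+ 2 * normal_pdf 0 s x <= 8 * s ^+ 2 * normal_pdf 0 (Num.sqrt 2 * s) x.
Proof.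
have s2 : Num.sqrt 2 * s != 0 by rewrite mulf_neq0 ?gt_eqF// sqrtr_gt0.
rewrite (normal_pdfE _ s2) (normal_pdfE _ (lt0r_neq0 s0)).
rewrite /normal_fun !subr0 exprMn sqr_sqrtr//.
have peak : normal_peak s <= 2 * normal_peak (Num.sqrt 2 * s).
  rewrite /normal_peak exprMn sqr_sqrtr//.
  rewrite (_ : 2 * s ^+ 2 * pi *+ 2 = 2 * (s ^+ 2 * pi *+ 2)); last by ring.
  rewrite (sqrtrM (s ^+ 2 * pi *+ 2))// invfM mulrA ler_peMl ?invr_ge0//.
  rewrite ler_pdivlMr ?sqrtr_gt0// mul1r -[leRHS]ger0_norm// -sqrtr_sqr.
  by rewrite ler_sqrt; lra.
set e1 := expR _; set e2 := expR _.
have e12 : x ^+ 2 * e1 <= 4 * s ^+ 2 * e2.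
  have -> : e1 = e2 * expR (- (x ^+ 2 / (4 * s ^+ 2))).
    rewrite /e1 /e2 -expRD; congr expR.
    by field; rewrite gt_eqF.
  rewrite mulrCA [leRHS]mulrC ler_pM2l ?expR_gt0//.
  rewrite expRN ler_pdivrMr ?expR_gt0//.
  rewrite -ler_pdivrMl ?mulr_gt0 ?exprn_gt0// mulrC.
  by rewrite (le_trans _ (expR_ge1Dx _))// lerDr.
rewrite (_ : x ^+ 2 * (normal_peak s * e1) = normal_peak s * (x ^+ 2 * e1)); last by ring.
rewrite (_ : 8 * s ^+ 2 * (normal_peak (Num.sqrt 2 * s) * e2) =
  (2 * normal_peak (Num.sqrt 2 * s)) * (4 * s ^+ 2 * e2)); last by ring.
apply: ler_pM => //; first exact: normal_peak_ge0.
by rewrite mulr_ge0 ?sqr_ge0 ?expR_ge0.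
Qed.

(** The exact value is [s ^+ 2]. The factor 8 is the price of the comparison [normal_pdf_sqr]: 4
    from the exponential, 2 from the ratio of the peaks. *)
Lemma normal_second_moment : (\int[P]_w (Z w ^+ 2)%:E <= (8 * s ^+ 2)%:E)%E.
Proof.
pose f (x : R) := (x ^+ 2)%:E.
have mf : measurable_fun setT f.
  by apply/measurable_EFinP; exact: measurable_funX.
rewrite (integralZ mf); last by move=> x; rewrite lee_fin sqr_ge0.
rewrite (@ge0_integral_density _ _ _ N lebesgue_measure
  (fun x => (normal_pdf 0 s x)%:E) f)//.
- apply: (@le_trans _ _
    (\int[lebesgue_measure]_x
       ((8 * s ^+ 2)%:E * (normal_pdf 0 (Num.sqrt 2 * s) x)%:E))%E).
    apply: ge0_le_integral => //.
    + by move=> x _; rewrite mule_ge0// lee_fin ?sqr_ge0// normal_pdf_ge0.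
    + apply: emeasurable_funM => //.
      by apply/measurable_EFinP; exact: measurable_normal_pdf.
    + apply: emeasurable_funM => //.
      by apply/measurable_EFinP; exact: measurable_normal_pdf.
    + by move=> x _; rewrite -!EFinM lee_fin normal_pdf_sqr.
  by rewrite integralZl ?integral_normal_pdf ?mule1//; exact: integrable_normal_pdf.
- exact: integrable_normal_pdf.
- by move=> x; rewrite lee_fin normal_pdf_ge0.
- by move=> x; rewrite lee_fin sqr_ge0.
Qed.

Lemma normal_sqr_integrable : P.-integrable setT (fun w => (Z w ^+ 2)%:E).
Proof.
apply/integrableP; split.
  by apply/measurable_EFinP; exact: measurable_funX.
under eq_integral => w _ do rewrite gee0_abs ?lee_fin ?sqr_ge0//.
by rewrite (le_lt_trans normal_second_moment) ?ltry.
Qed.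

Lemma normal_integrable : P.-integrable setT (EFin \o Z).
Proof.
have i1 : P.-integrable setT (fun w => (1 + Z w ^+ 2)%:E).
  apply: (@integrableD _ _ _ P setT measurableT (EFin \o (fun=> 1))
    (fun w => (Z w ^+ 2)%:E)) => //; last exact: normal_sqr_integrable.
  apply: (@bounded_integrable _ _ _ P (fun=> 1) 1) => //.
  by move=> _; rewrite normr1.
apply: (le_integrable measurableT _ _ i1); first exact/measurable_EFinP.
move=> w _ /=; rewrite lee_fin [leRHS]ger0_norm ?addr_ge0 ?sqr_ge0//.
have : 0 <= (1 - `|Z w|) ^+ 2 by exact: sqr_ge0.
rewrite sqrrB expr1n mul1r real_normK ?num_real//.
by have : 0 <= `|Z w| by []; lra.
Qed.

Let normal_probN (A : set R) : measurable A ->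
  normal_prob 0 s ((-%R : R -> R) @^-1` A) = normal_prob 0 s A.
Proof.
move=> mA; rewrite /normal_prob.
have mopp : @measurable_fun _ _ (measurableTypeR R) (measurableTypeR R) setT -%R.
  exact: (@oppr_measurable R setT).
transitivity (\int[pushforward (@lebesgue_measure R)
    (-%R : _ -> measurableTypeR R)]_(x in A) (normal_pdf 0 s x)%:E)%E; last first.
  by apply: eq_measure_integral => //= B mB _; exact: lebesgue_measureN.
rewrite (ge0_integral_pushforward mopp)//=.
- apply: eq_integral => x _ /=; congr EFin.
  by rewrite !(normal_pdfE _ (lt0r_neq0 s0)) /normal_fun !subr0 sqrrN.
- by apply: measurable_funTS; apply/measurable_EFinP; exact: measurable_normal_pdf.
- by move=> x _; rewrite lee_fin normal_pdf_ge0.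
Qed.

(** By symmetry [Z] and [- Z] have the same law, so the mean equals its own opposite. *)
Lemma normal_mean : \int[P]_w Z w = 0.
Proof.
have mNZ : measurable_fun setT (fun w => - Z w) by exact: measurableT_comp.
have iNZ : P.-integrable setT (EFin \o (fun w => - Z w)).
  have := @integrableZl _ _ _ P setT measurableT (-1) _ normal_integrable.
  by apply: eq_integrable => // w _ /=; rewrite -EFinM mulN1r.
have : \int[P]_w Z w = \int[P]_w (- Z w).
  rewrite /Rintegral; congr fine.
  have := @integral_distribution _ _ _ _ _ P (mfun_Sub (mem_set mZ)) EFin.
  rewrite /= => <- //; last exact: normal_integrable.
  have := @integral_distribution _ _ _ _ _ P (mfun_Sub (mem_set mNZ)) EFin.
  rewrite /= => <- //.
  apply: eq_measure_integral => A mA _.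
  rewrite /distribution/= /pushforward.
  have mNA : measurable ((-%R : R -> R) @^-1` A).
    by rewrite -[X in measurable X]setTI; exact: (@oppr_measurable R setT).
  rewrite [LHS]lawZ// -normal_probN//.
  by rewrite -lawZ.
have -> : \int[P]_w - Z w = - \int[P]_w Z w.
  under eq_Rintegral do rewrite -mulN1r.
  by rewrite RintegralZl ?mulN1r//; exact: normal_integrable.
by lra.
Qed.

End normal_moments.

(** * Gaussian walks in several dimensions *)

Lemma measure_bigsetU_le {R : realType} {disp : measure_display}
    {T : measurableType disp} (mu : {measure set T -> \bar R})
    (I : Type) (r : seq I) (A : I -> set T) :
  (forall i, measurable (A i)) ->
  (mu (\big[setU/set0]_(i <- r) A i) <= \sum_(i <- r) mu (A i))%E.
Proof.
move=> mA; elim: r => [|i r IH]; first by rewrite !big_nil measure0.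
rewrite !big_cons (le_trans (measureU2 _ _ _))//.
  exact: bigsetU_measurable.
by rewrite leeD2l.
Qed.

Lemma measurable_walk_event {R : realType} {disp : measure_display}
    {T : measurableType disp} {d : nat} (W : nat -> T -> 'rV[R]_d)
    (lam : R) (n : nat) : (forall j, measurable_fun setT (W j)) ->
  measurable [set w | forall j i, (j <= n)%N -> `|W j w 0 i| <= lam].
Proof.
move=> mW.
have -> : [set w | forall j i, (j <= n)%N -> `|W j w 0 i| <= lam] =
    \big[setI/setT]_(i < d) \bigcap_(j in [set j | (j <= n)%N])
      (fun w => W j w 0 i) @^-1` `[-lam, lam]%classic.
  rewrite -bigcap_seq; apply/seteqP; split => [w h i _ j jn|w h j i jn].
    by have := h j i jn; rewrite /= in_itv/= ler_norml.
  by have := h i (mem_index_enum i) j jn; rewrite /= in_itv/= -ler_norml.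
apply: bigsetI_measurable => i _; apply: bigcap_measurable; first by exists 0%N.
move=> j _; rewrite -[X in measurable X]setTI.
exact: (measurableT_comp (measurable_rV_coord i) (mW j)).
Qed.

Section gaussian_walk.
Context {R : realType} {disp : measure_display} {T : measurableType disp}.
Context {d : nat}.
Variable P : probability T R.
Variables (F : nat -> set (set T)) (W : nat -> T -> 'rV[R]_d) (C : set T).
Variables (s : R) (n : nat).
Hypothesis s0 : 0 < s.
Hypothesis Fsigma : forall j, sigma_algebra setT (F j).
Hypothesis Fmeas : forall j, F j `<=` measurable.
Hypothesis Fincr : forall j, F j `<=` F j.+1.
Hypothesis FC : F 0%N C.
Hypothesis FW : forall j B, measurable B -> F j (W j @^-1` B).
Hypothesis W0 : forall w, W 0%N w = 0.
Hypothesis gaussian : forall j,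
  isotropic_gaussian P s (fun w => W j.+1 w - W j w).
Hypothesis indep : forall j D B, F j D -> measurable B ->
  P (D `&` [set w | B (W j.+1 w - W j w)]) =
  (P D * P [set w | B (W j.+1 w - W j w)%R])%E.

(** Kolmogorov's inequality in each coordinate and a union bound: the exit probability relative to
    [C] is at most [d * n * 8 s^2 / lam^2], and 16 is what makes it at most one half. *)
Lemma gaussian_walk_bound (lam : R) : 0 < lam -> (16 * d * n)%:R * s ^+ 2 <= lam ^+ 2 ->
  ((2^-1)%:E * P C <=
   P (C `&` [set w | forall j i, (j <= n)%N -> (`|W j w 0 i| <= lam)%R]))%E.
Proof.
move=> lam0 nlam.
pose E (i : 'I_d) := [set w | forall j, (j <= n)%N -> `|W j w 0 i| <= lam].
have mcoord (i : 'I_d) (B : set R) : measurable B ->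
    measurable [set x : 'rV[R]_d | B (x 0 i)].
  move=> mB; rewrite -[X in measurable X]setTI.
  exact: (measurable_rV_coord i).
have mW j i : measurable_fun setT (fun w => W j w 0 i).
  move=> _ B mB; rewrite setTI; apply: (@Fmeas j).
  exact: (@FW j _ (mcoord i B mB)).
have mC : measurable C by exact: Fmeas FC.
have mE i : measurable (E i).
  have -> : E i = \bigcap_(j in [set j | (j <= n)%N])
      (fun w => W j w 0 i) @^-1` `[-lam, lam]%classic.
    apply/seteqP; split => w /= h j /h/=; by rewrite in_itv/= ler_norml.
  apply: bigcap_measurable; first by exists 0%N.
  by move=> j _; rewrite -[X in measurable X]setTI; exact: mW.
have diffE j i w : (W j.+1 w - W j w) 0 i = W j.+1 w 0 i - W j w 0 i.
  by rewrite !mxE.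
have law j i A : measurable A ->
    P [set w | A (W j.+1 w 0 i - W j w 0 i)] = normal_prob 0 s A.
  move=> mA; have [_ _ /(_ i A mA) <-] := gaussian j.
  by congr (P _); apply/seteqP; split => w /=; rewrite diffE.
have mD j i : measurable_fun setT (fun w => W j.+1 w 0 i - W j w 0 i).
  exact: measurable_funB.
have PE i : ((lam ^+ 2)%:E * P (C `\` E i) <= P C * (n%:R * (8 * s ^+ 2))%:E)%E.
  apply: (kolmogorov (F := F) (W := fun j w => W j w 0 i) (lam := lam)) => //.
  - exact: ltW.
  - by move=> j B mB; exact: (@FW j _ (mcoord i B mB)).
  - by move=> w; rewrite W0 mxE.
  - move=> j D B FD mB; have := indep FD (mcoord i B mB).
    rewrite (_ : [set w | _] = (fun w => W j.+1 w 0 i - W j w 0 i) @^-1` B)//.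
    by apply/seteqP; split => w /=; rewrite diffE.
  - by move=> j; exact: (normal_integrable s0 (mD j i) (law j i)).
  - by move=> j; exact: (normal_sqr_integrable s0 (mD j i) (law j i)).
  - by move=> j; exact: (normal_mean s0 (mD j i) (law j i)).
  - move=> j; rewrite -lee_fin /Rintegral fineK.
      exact: (normal_second_moment s0 (mD j i) (law j i)).
    apply: integrable_fin_num => //.
    exact: (normal_sqr_integrable s0 (mD j i) (law j i)).
set G := [set w | _].
have GE : C `\` G `<=` \big[setU/set0]_(i < d) (C `\` E i).
  move=> w [Cw nG]; rewrite -bigcup_seq.
  apply: contrapT => nU; apply: nG => j i jn.
  apply: contrapT => nW; apply: nU.
  by exists i; [exact: mem_index_enum|split] => // /(_ j jn).
have mG : measurable G.
  by apply: measurable_walk_event => j _ B mB; rewrite setTI; exact/(@Fmeas j)/FW.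
have PCG : P (C `\` G) = (fine (P (C `\` G)))%:E.
  by rewrite fineK// fin_num_measure//; exact: measurableD.
have PCE : P C = (fine (P C))%:E by rewrite fineK// fin_num_measure.
have half : fine (P (C `\` G)) <= 2^-1 * fine (P C).
  have PCEi i : fine (P (C `\` E i)) <= fine (P C) * (n%:R * (8 * s ^+ 2)) / lam ^+ 2.
    rewrite ler_pdivlMr ?exprn_gt0// mulrC -lee_fin EFinM [leRHS]EFinM -PCE fineK ?PE//.
    by rewrite fin_num_measure//; exact: measurableD.
  have : fine (P (C `\` G)) <= \sum_(i < d) fine (P (C `\` E i)).
    rewrite -lee_fin -PCG -sumEFin.
    rewrite (eq_bigr (fun i => P (C `\` E i))); last first.
      by move=> i _; rewrite fineK// fin_num_measure//; exact: measurableD.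
    apply: (le_trans (le_measure _ _ _ GE)); rewrite ?inE.
    - exact: measurableD.
    - by apply: bigsetU_measurable => i _; exact: measurableD.
    - by apply: measure_bigsetU_le => i; exact: measurableD.
  move=> /le_trans; apply.
  apply: (le_trans (ler_sum _ (fun i _ => PCEi i))).
  rewrite sumr_const card_ord -[leLHS]mulr_natr [leRHS]mulrC.
  set p := fine (P C); have p0 : 0 <= p by rewrite fine_ge0.
  rewrite (_ : _ / _ * _ = p * (n%:R * (8 * s ^+ 2) * d%:R / lam ^+ 2)); last by ring.
  apply: (ler_wpM2l p0); rewrite ler_pdivrMr ?exprn_gt0//.
  by move: nlam; rewrite !natrM; lra.
have -> : P (C `&` G) = (P C - P (C `\` G))%E.
  rewrite (measureDI P mC mG) addeAC subee ?add0e// fin_num_measure//.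
  exact: measurableD.
rewrite PCG PCE -EFinM -EFinB lee_fin.
by move: half; lra.
Qed.

End gaussian_walk.

(** * Noise of the chain and of the diffusion *)

Section independence.
Context {R : realType} {disp disp' : measure_display}.
Context {T : measurableType disp} {S : measurableType disp'}.
Variables (P : probability T R) (I : choiceType) (X : I -> T -> S).
Hypothesis mX : forall i, measurable_fun setT (X i).
Hypothesis indepX : mutually_independent P X.

(** The sigma-algebra generated by the [X i] with [i] in [J]. Finite lists are enough: at each step
    the chain has used finitely many variables. *)
Definition gen_sigma (J : seq I) : set (set T) :=
  <<s [set D | exists2 i, i \in J &
        exists2 A, measurable A & D = X i @^-1` A] >>.

Let rect (J : seq I) : set (set T) :=
  [set D | exists2 A : I -> set S, (forall i, measurable (A i)) &
    D = \bigcap_(i in [set` J]) X i @^-1` A i].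

Let mpre i A : measurable A -> measurable (X i @^-1` A).
Proof. by move=> mA; rewrite -[X in measurable X]setTI; exact: mX. Qed.

Let mrect J D : rect J D -> measurable D.
Proof.
move=> [A mA ->]; rewrite bigcap_seq.
by apply: bigsetI_measurable => i _; exact: mpre.
Qed.

Lemma gen_sigma_measurable J : gen_sigma J `<=` measurable.
Proof.
apply: smallest_sub; first exact: sigma_algebra_measurable.
by move=> D [i _ [A mA ->]]; exact: mpre.
Qed.

Let gen_sigma_dynkin J : gen_sigma J `<=` <<d rect J >>.
Proof.
rewrite setI_closed_g_dynkin_g_sigma_algebra.
  apply: smallest_sub; first exact: smallest_sigma_algebra.
  move=> D [i iJ [A mA ->]]; apply: sub_sigma_algebra.
  exists (fun l => if l == i then A else setT).
    by move=> l; case: ifP.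
  apply/seteqP; split => w.
    by move=> Aw l _ /=; case: eqP => // ->.
  by move=> /(_ i iJ)/=; rewrite eqxx.
move=> D1 D2 [A1 mA1 ->] [A2 mA2 ->].
exists (fun i => A1 i `&` A2 i); first by move=> i; exact: measurableI.
by rewrite -bigcapI.
Qed.

(** Dynkin's theorem: the events independent of [X i] form a Dynkin system, which contains the
    rectangles over [J] by mutual independence, and these are stable under intersection. *)
Lemma gen_sigma_indep J i D B : uniq J -> i \notin J ->
  gen_sigma J D -> measurable B ->
  P (D `&` X i @^-1` B) = (P D * P (X i @^-1` B))%E.
Proof.
move=> uJ iJ /gen_sigma_dynkin + mB; set E := X i @^-1` B.
have mE : measurable E by exact: mpre.
suff : <<d rect J >> `<=`
    [set D | measurable D /\ P (D `&` E) = (P D * P E)%E].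
  by move=> /[apply] -[].
apply: smallest_sub; last first.
  move=> {}D rD; split; first exact: mrect rD.
  case: rD => A mA ->.
  pose A' l := if l == i then B else A l.
  have A'A l : l \in J -> A' l = A l.
    by rewrite /A' => lJ; case: eqP => // li; move: iJ; rewrite -li lJ.
  have := @indepX (i :: J) A'; rewrite /= iJ uJ => /(_ isT).
  have mA' l : measurable (A' l) by rewrite /A'; case: ifP.
  move=> /(_ mA'); rewrite big_cons.
  have -> : \bigcap_(l in [set` i :: J]) X l @^-1` A' l =
      \bigcap_(l in [set` J]) X l @^-1` A l `&` E.
    apply/seteqP; split => w.
      move=> h; split => [l lJ|].
        by rewrite -A'A//; apply: h; rewrite /= in_cons lJ orbT.
      by have := h i; rewrite /= in_cons eqxx /A' eqxx /E => /(_ isT).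
    move=> [h1 h2] l /=; rewrite in_cons => /orP[/eqP ->|lJ].
      by rewrite /A' eqxx.
    by rewrite A'A//; exact: h1.
  move=> ->; rewrite {1}/A' eqxx muleC; congr (_ * _)%E.
  rewrite (@indepX J A uJ mA).
  by apply: eq_big_seq => l lJ; rewrite A'A.
split.
- by split => //; rewrite setTI probability_setT mul1e.
- move=> A [mA PA]; split; first exact: measurableC.
  rewrite setIC -setDE measureD//; last first.
    by rewrite (le_lt_trans (probability_le1 _ _)) ?ltry.
  rewrite [X in (_ - X)%E](_ : _ = (P A * P E)%E); last by rewrite setIC.
  rewrite probability_setC//.
  rewrite muleBl ?mul1e ?fin_num_measure//.
- move=> A tA PA; split; first by apply: bigcupT_measurable => n; case: (PA n).
  have mA n : measurable (A n) by case: (PA n).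
  rewrite setI_bigcupl !measure_bigcup//; first last.
  + exact: trivIset_setIr.
  + by move=> n _; exact: measurableI.
  have PEE : P E = (fine (P E))%:E by rewrite fineK// fin_num_measure.
  rewrite [RHS]muleC PEE -nneseriesZl//.
  apply: eq_eseriesr => n _; case: (PA n) => _ h.
  by rewrite -PEE muleC; exact: h.
Qed.

End independence.

Section lmc_noise.
Context {R : realType} {disp : measure_display} {T : measurableType disp}.
Context {d : nat}.
Variable P : probability T R.
Variables (V : 'rV[R]_d -> R) (h : R) (x xi : nat -> T -> 'rV[R]_d).
Hypothesis chain : lmc_chain P V h x xi.

(** The partial sums of the [xi] form a Gaussian walk with unit steps in the filtration generated by
    the initial point and the past noise; the event that [x 0] lies in [A] plays the role of [C]. *)
Lemma lmc_noise_bound (A : set 'rV[R]_d) (k : nat) (lam : R) :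
  measurable A -> 0 < lam -> (16 * d * k)%:R <= lam ^+ 2 ->
  ((2^-1)%:E * P (x 0%N @^-1` A) <=
   P (x 0%N @^-1` A `&` [set w | forall j i, (j <= k)%N ->
        (`|(\sum_(l < j) xi l w) 0 i| <= lam)%R]))%E.
Proof.
move=> mA lam0 klam; case: chain => mx0 gxi indep _.
pose X (o : option nat) := if o is Some k then xi k else x 0%N.
have mX o : measurable_fun setT (X o) by case: o => [l|//]; case: (gxi l).
(* The variables known at time [j]: the initial point, indexed by [None], and [xi 0], ...,
   [xi j.-1]. The next increment [xi j] is thus outside the list. *)
pose J j := None :: map Some (iota 0 j).
have JS j : {subset J j <= J j.+1}.
  move=> o; rewrite /J -addn1 iotaD map_cat !in_cons mem_cat => /orP[->//|->].
  by rewrite orbT.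
have inJ l j : (l < j)%N -> Some l \in J j.
  by move=> lj; rewrite in_cons/=; apply: map_f; rewrite mem_iota.
apply: (@gaussian_walk_bound _ _ _ _ P (fun j => gen_sigma X (J j))
  (fun j w => \sum_(l < j) xi l w) _ 1 k).
- exact: ltr01.
- by move=> j; exact: smallest_sigma_algebra.
- by move=> j; exact: gen_sigma_measurable.
- move=> j; apply: sub_sigma_algebra2.
  move=> D [p pJ hD]; exists p => //.
  exact: JS.
- by apply: sub_sigma_algebra; exists None => //; exists A.
- move=> j B mB.
  suff : measurable_fun [set: g_sigma_algebraType [set D | exists2 i, i \in J j &
        exists2 A, measurable A & D = X i @^-1` A]]
      ((fun w => \sum_(l < j) xi l w) : g_sigma_algebraType _ -> 'rV[R]_d).
    by move=> /(_ measurableT B mB); rewrite setTI.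
  apply/measurable_fun_rVP => i.
  rewrite (_ : (fun _ => _) = fun t => \sum_(l < j) xi l t 0 i); last first.
    by apply/funext => t; rewrite summxE.
  apply: measurable_sum => l.
  apply: (measurableT_comp (measurable_rV_coord i)) => _ D mD.
  rewrite setTI; apply: sub_sigma_algebra; exists (Some (l : nat)).
    exact: inJ.
  by exists D.
- by move=> w; rewrite big_ord0.
- move=> j; have := gxi j; congr isotropic_gaussian.
  by apply/funext => w; rewrite big_ord_recr/= addrAC subrr add0r.
- move=> j D B GD mB.
  have -> : [set w | B (\sum_(l < j.+1) xi l w - \sum_(l < j) xi l w)] =
      X (Some j) @^-1` B.
    by apply/seteqP; split => w /=; rewrite big_ord_recr/= addrAC subrr add0r.
  apply: (gen_sigma_indep mX indep _ _ GD mB).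
    rewrite /= map_inj_uniq ?iota_uniq ?andbT; last by move=> ? ? [].
    by apply/mapP => -[].
  rewrite in_cons/=; apply/mapP => -[l]; rewrite mem_iota/= add0n => lj [jl].
  by move: lj; rewrite jl ltnn.
- by [].
- by rewrite expr1n mulr1.
Qed.

End lmc_noise.

Lemma rV_coord_le_norm {R : realType} {d : nat} (x : 'rV[R]_d) (i : 'I_d) :
  `|x 0 i| <= `|x|.
Proof.
rewrite [leRHS]mx_normrE.
exact: (le_bigmax _ (fun ij => `|x ij.1 ij.2|) (0, i)).
Qed.

Section brownian_noise.
Context {R : realType} {disp : measure_display} {T : measurableType disp}.
Context {d : nat}.
Variable P : probability T R.
Variables (F : R -> set (set T)) (B : R -> T -> 'rV[R]_d).
Hypothesis filF : filtration F.
Hypothesis BM : brownian_motion P F B.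
Variables (C : set T) (t lam : R).
Hypothesis FC : F 0 C.
Hypothesis t0 : 0 < t.
Hypothesis lam0 : 0 < lam.
Hypothesis tlam : 16 * d%:R * t <= lam ^+ 2.

(** Dyadic subdivision of the time interval: passing from [m] to [m.+1] only adds points, so the
    grid events decrease. *)
Let grid (m j : nat) : R := t * j%:R / (2 ^ m)%:R.

Let pow2_gt0 m : 0 < (2 ^ m)%:R :> R.
Proof. by rewrite ltr0n expn_gt0. Qed.

Let grid_ge0 m j : 0 <= grid m j.
Proof. by rewrite divr_ge0 ?mulr_ge0 ?ler0n// ltW. Qed.

Let gridS m j : grid m j.+1 - grid m j = t / (2 ^ m)%:R.
Proof. by rewrite /grid -natr1 mulrDr mulr1 mulrDl addrAC subrr add0r. Qed.

Let grid_lt m j : grid m j < grid m j.+1.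
Proof. by rewrite -subr_gt0 gridS divr_gt0. Qed.

(** Displacements are measured from [B 0] because the walk bound asks for a walk starting at 0
    everywhere, while [B 0] vanishes only almost surely. *)
Definition bm_grid_event (m : nat) : set T :=
  [set w | forall j i, (j <= 2 ^ m)%N ->
     `|(B (t * j%:R / (2 ^ m)%:R) w - B 0 w) 0 i| <= lam].

(** There are [2 ^ m] steps of variance [t / 2 ^ m], so the condition on [lam] is the same at every
    level [m]. *)
Lemma bm_grid_bound m : ((2^-1)%:E * P C <= P (C `&` bm_grid_event m))%E.
Proof.
have [Fs Fm Fle] := filF; have [adB _ _ gB iB] := BM.
apply: (@gaussian_walk_bound _ _ _ _ P (fun j => F (grid m j))
  (fun j w => B (grid m j) w - B 0 w) C (Num.sqrt (t / (2 ^ m)%:R)) (2 ^ m)%N).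
- by rewrite sqrtr_gt0 divr_gt0.
- by move=> j; exact: Fs.
- by move=> j; exact: Fm.
- by move=> j; apply: Fle => //; exact: ltW.
- by rewrite {1}/grid mulr0 mul0r.
- move=> j A mA; rewrite -(sigma_algebra_id (Fs _ (grid_ge0 m j))).
  have mBs s : 0 <= s -> s <= grid m j ->
      measurable_fun [set: g_sigma_algebraType (F (grid m j))]
        (B s : g_sigma_algebraType (F (grid m j)) -> 'rV[R]_d).
    move=> s0 sj _ D mD; rewrite setTI; apply: sub_sigma_algebra.
    by apply: (Fle _ _ s0 sj); exact: adB.
  have : measurable_fun [set: g_sigma_algebraType (F (grid m j))]
      ((fun w => B (grid m j) w - B 0 w) :
        g_sigma_algebraType (F (grid m j)) -> 'rV[R]_d).
    apply/measurable_fun_rVP => i.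
    rewrite (_ : (fun _ => _) = fun w => B (grid m j) w 0 i - B 0 w 0 i).
      apply: measurable_funB.
        by apply: (measurableT_comp (measurable_rV_coord i)); exact: mBs.
      by apply: (measurableT_comp (measurable_rV_coord i)); exact: mBs.
    by apply/funext => w; rewrite !mxE.
  by move=> /(_ measurableT A mA); rewrite setTI.
- by move=> w; rewrite /grid mulr0 mul0r subrr.
- move=> j; have := gB _ _ (grid_ge0 m j) (grid_lt m j).
  rewrite gridS; congr isotropic_gaussian; apply/funext => w.
  by rewrite opprB addrA subrK.
- move=> j D A FD mA.
  have E w : B (grid m j.+1) w - B 0 w - (B (grid m j) w - B 0 w) =
     B (grid m j.+1) w - B (grid m j) w by rewrite opprB addrA subrK.
  rewrite (_ : [set w | _] = [set w | A (B (grid m j.+1) w - B (grid m j) w)]).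
    exact: (iB _ _ (grid_ge0 m j) (grid_lt m j) D A FD mA).
  by apply/seteqP; split => w /=; rewrite E.
- by [].
- rewrite sqr_sqrtr; last by rewrite divr_ge0// ltW.
  by rewrite 2!natrM -mulrA (mulrCA _ t) mulfV ?gt_eqF// mulr1.
Qed.

Let mgrid m : measurable (bm_grid_event m).
Proof.
have [Fs Fm Fle] := filF; have [adB _ _ gB iB] := BM.
have mB s : 0 <= s -> measurable_fun setT (B s).
  by move=> s0 _ D mD; rewrite setTI; apply: (Fm s s0); exact: adB.
apply: (measurable_walk_event (W := fun j w => B (grid m j) w - B 0 w)) => j.
apply/measurable_fun_rVP => i.
rewrite (_ : (fun _ => _) = fun w => B (grid m j) w 0 i - B 0 w 0 i).
  apply: measurable_funB.
    by apply: (measurableT_comp (measurable_rV_coord i)); exact: mB.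
  by apply: (measurableT_comp (measurable_rV_coord i)); exact: mB.
by apply/funext => w; rewrite !mxE.
Qed.

Let grid_dec m : bm_grid_event m.+1 `<=` bm_grid_event m.
Proof.
move=> w h j i jm; have := h (2 * j)%N i.
rewrite expnS leq_mul2l jm orbT => /(_ isT).
rewrite !natrM (mulrCA t) -mulf_div divff ?mul1r//.
Qed.

Definition bm_event : set T := \bigcap_m (C `&` bm_grid_event m).

Lemma measurable_bm_event : measurable bm_event.
Proof.
have [Fs Fm Fle] := filF.
by apply: bigcapT_measurable => m; apply: measurableI => //; exact: Fm FC.
Qed.

(** Continuity from above along the decreasing grid events, which all satisfy the same lower
    bound. *)
Lemma bm_event_bound : ((2^-1)%:E * P C <= P bm_event)%E.
Proof.
have [Fs Fm Fle] := filF.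
have mCE m : measurable (C `&` bm_grid_event m).
  by apply: measurableI => //; exact: Fm FC.
have cv : P \o (fun m => C `&` bm_grid_event m) @ \oo --> P bm_event.
  apply: nonincreasing_cvg_mu => //.
  - by rewrite (le_lt_trans (probability_le1 _ _)) ?ltry.
  - exact: measurable_bm_event.
  - apply/nonincreasing_seqP => m; apply/subsetPset.
    by apply: setIS; exact: grid_dec.
by apply: (cvge_ge _ cv); apply: nearW => m; exact: bm_grid_bound.
Qed.

(** A continuous path that exceeds [lam] at [s] would still exceed it at a dyadic time close enough
    to [s]. *)
Lemma bm_event_path w s i : bm_event w ->
  {within `[0, +oo[, continuous (fun u : R => B u w)} ->
  0 <= s <= t -> `|(B s w - B 0 w) 0 i| <= lam.
Proof.
move=> Ew cB /andP[s0 st]; rewrite leNgt; apply/negP => lams.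
have /subspace_continuousP/(_ s) := cB.
rewrite /= in_itv/= s0 => /(_ isT).
pose e := `|(B s w - B 0 w) 0 i| - lam.
have e0 : 0 < e by rewrite subr_gt0.
move=> /cvgrPdist_lt/(_ e e0).
rewrite near_withinE => /nbhs_ballP[del /= del0 near_s].
have [m mdel] : exists m, t / (2 ^ m)%:R < del.
  exists (Num.truncn (t / del)).+1.
  rewrite ltr_pdivrMr// mulrC -ltr_pdivrMr//.
  rewrite (lt_le_trans (truncnS_gt _))// ler_nat ltnW//.
  exact: ltn_expl.
(* Index of the last grid point not after [s]; approaching from the left keeps the grid point inside
   the time interval. *)
pose j := Num.truncn (s * (2 ^ m)%:R / t).
have js : (j%:R <= s * (2 ^ m)%:R / t < j.+1%:R).
  by apply: truncn_itv; rewrite divr_ge0 ?mulr_ge0// ltW.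
move: js => /andP[js1 js2].
have j2m : (j <= 2 ^ m)%N.
  rewrite -(ler_nat R) (le_trans js1)// ler_pdivrMr// mulrC ler_pM2l//.
pose u := t * j%:R / (2 ^ m)%:R.
have us : u <= s.
  by rewrite /u ler_pdivrMr// mulrC -ler_pdivlMr.
have su : s - u < del.
  apply: (lt_trans _ mdel).
  rewrite ltrBlDr /u -mulrDl ltr_pdivlMr// -[X in X + _]mulr1 -mulrDr nat1r.
  by rewrite -ltr_pdivrMl// mulrC.
have u0 : 0 <= u by rewrite divr_ge0 ?mulr_ge0 ?ler0n// ltW.
have := near_s u; rewrite /ball/= ger0_norm ?subr_ge0// => /(_ su).
rewrite in_itv/= u0 => /(_ isT) Bsu.
have [_ /(_ j i j2m)] := Ew m I; rewrite -/u => Bu.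
have : `|(B s w - B u w) 0 i| < e.
  by apply: le_lt_trans Bsu; exact: rV_coord_le_norm.
rewrite /e ltrBrDr => h.
have : `|(B s w - B 0 w) 0 i| <= `|(B s w - B u w) 0 i| + `|(B u w - B 0 w) 0 i|.
  rewrite (le_trans _ (ler_normD _ _))//.
  by rewrite !mxE addrA subrK.
by move: h Bu; lra.
Qed.

End brownian_noise.

(** * Mass of the boxes *)

Section enorm_theory.
Context {R : realType} {d : nat}.
Implicit Types x y : 'rV[R]_d.

Lemma enorm_ge0 x : 0 <= enorm x.
Proof. exact: sqrtr_ge0. Qed.

Lemma sqr_enorm x : enorm x ^+ 2 = \sum_(i < d) x 0 i ^+ 2.
Proof. by rewrite sqr_sqrtr// sumr_ge0// => i _; exact: sqr_ge0. Qed.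

Lemma coord_le_enorm x i : `|x 0 i| <= enorm x.
Proof.
rewrite -sqrtr_sqr ler_sqrt; last by rewrite sumr_ge0// => j _; exact: sqr_ge0.
by rewrite (bigD1 i)//= lerDl sumr_ge0// => j _; exact: sqr_ge0.
Qed.

Lemma enorm_le x (M : R) : 0 <= M -> (forall i, `|x 0 i| <= M) ->
  enorm x <= d%:R * M.
Proof.
move=> M0 xM; have dM : 0 <= d%:R * M by rewrite mulr_ge0.
rewrite -(ler_pXn2r (n := 2))// ?nnegrE ?enorm_ge0// sqr_enorm.
apply: (@le_trans _ _ (\sum_(i < d) M ^+ 2)).
  by apply: ler_sum => i _; rewrite -real_normK ?num_real// lerXn2r ?nnegrE.
rewrite sumr_const card_ord -[leLHS]mulr_natl exprMn ler_wpM2r ?sqr_ge0//.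
case: {+}d => [|k]; first by rewrite expr0n.
by rewrite -natrX ler_nat expnS leq_pmulr// expn1.
Qed.

(** Cauchy-Schwarz, by expanding the squared norm of [enorm y *: x - enorm x *: y]; the result is
    divided by [enorm x * enorm y], so the case where this product vanishes is treated apart. *)
Lemma dotprod_le_enorm x y : \sum_(i < d) x 0 i * y 0 i <= enorm x * enorm y.
Proof.
have nx := enorm_ge0 x; have ny := enorm_ge0 y.
have [xy0|xy0] := eqVneq (enorm x * enorm y) 0.
  have coord0 (z : 'rV[R]_d) : enorm z = 0 -> forall i, z 0 i = 0.
    move=> z0 i; have := coord_le_enorm z i; rewrite z0 normr_le0.
    by move=> /eqP.
  rewrite xy0 big1// => i _.
  move/eqP: xy0; rewrite mulf_eq0 => /orP[]/eqP/coord0 ->.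
    by rewrite mul0r.
  by rewrite mulr0.
have p0 : 0 < enorm x * enorm y by rewrite lt_neqAle eq_sym xy0 mulr_ge0.
rewrite -(ler_pM2r (x := 2 * (enorm x * enorm y)))//; last by rewrite mulr_gt0.
have : 0 <= \sum_(i < d) (enorm y * x 0 i - enorm x * y 0 i) ^+ 2.
  by apply: sumr_ge0 => i _; exact: sqr_ge0.
have -> : \sum_(i < d) (enorm y * x 0 i - enorm x * y 0 i) ^+ 2 =
    2 * (enorm x * enorm y) ^+ 2 -
    2 * (enorm x * enorm y) * \sum_(i < d) x 0 i * y 0 i.
  transitivity (\sum_(i < d) (enorm y ^+ 2 * x 0 i ^+ 2 + enorm x ^+ 2 * y 0 i ^+ 2
     - 2 * (enorm x * enorm y) * (x 0 i * y 0 i))).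
    by apply: eq_bigr => i _; ring.
  rewrite sumrB big_split/= -!mulr_sumr -!sqr_enorm; ring.
by lra.
Qed.

Lemma enormD x y : enorm (x + y) <= enorm x + enorm y.
Proof.
have nx := enorm_ge0 x; have ny := enorm_ge0 y.
rewrite -(ler_pXn2r (n := 2))// ?nnegrE ?enorm_ge0 ?addr_ge0//.
rewrite sqrrD !sqr_enorm.
have -> : \sum_(i < d) (x + y) 0 i ^+ 2 = \sum_(i < d) x 0 i ^+ 2 +
    2 * (\sum_(i < d) x 0 i * y 0 i) + \sum_(i < d) y 0 i ^+ 2.
  by rewrite mulr_sumr -!big_split/=; apply: eq_bigr => i _; rewrite mxE; ring.
by rewrite lerD2r lerD2l mulr2n; have := dotprod_le_enorm x y; lra.
Qed.

Lemma enormZ (a : R) x : enorm (a *: x) = `|a| * enorm x.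
Proof.
rewrite /enorm -sqrtr_sqr -sqrtrM ?sqr_ge0//; congr Num.sqrt.
by rewrite mulr_sumr; apply: eq_bigr => i _; rewrite mxE exprMn.
Qed.

Lemma enormN x : enorm (- x) = enorm x.
Proof. by rewrite -scaleN1r enormZ normrN1 mul1r. Qed.

Lemma enormB x y : enorm x - enorm y <= enorm (x - y).
Proof. by rewrite lerBlDr (le_trans _ (enormD _ _))// subrK. Qed.

Lemma measurable_enorm : measurable_fun setT (@enorm R d).
Proof.
have msq : measurable_fun setT (fun x : 'rV[R]_d => \sum_(i < d) x 0 i ^+ 2).
  apply: measurable_sum => i; apply: measurable_funX.
  exact: measurable_rV_coord.
by apply: measurableT_comp msq; apply: continuous_measurable_fun; exact: sqrt_continuous.
Qed.

End enorm_theory.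

(** * Growth of the potential *)

Section potential.
Context {R : realType} {d : nat}.
Variables (b alpha : R) (V : 'rV[R]_d -> R).
Hypothesis b0 : 0 < b.
Hypothesis dV : forall x, differentiable V x.
Hypothesis gradV : forall x, enorm (grad V x) <=
  b * enorm x / (1 + enorm x ^+ 2) `^ (1 - alpha / 2).

Lemma derive_grad (x v : 'rV[R]_d) :
  'D_v V x = \sum_(i < d) v 0 i * grad V x 0 i.
Proof.
rewrite deriveE// [in LHS](row_sum_delta v) linear_sum/=.
by apply: eq_bigr => i _; rewrite linearZ/= mxE deriveE.
Qed.

Let is_derive_ray (x : 'rV[R]_d) (t : R) :
  is_derive t 1 (fun u : R => V (u *: x)) ('D_x V (t *: x)).
Proof.
have E : (fun h => h^-1 *: (((fun u : R => V (u *: x)) \o shift t) (h *: 1) -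
      V (t *: x))) =
    (fun h => h^-1 *: ((V \o shift (t *: x)) (h *: x) - V (t *: x))).
  by apply/funext => h /=; rewrite /shift/= scalerDl [h *: 1]mulr1.
apply: DeriveDef; first by rewrite /derivable E; exact: diff_derivable.
by rewrite /derive E.
Qed.

(** [W] is a primitive of a radial bound on the gradient. Along the ray through [x], the derivative
    of [V (t *: x) - W (t * enorm x)] is nonpositive by Cauchy-Schwarz. As [V] is merely
    differentiable, the mean value theorem replaces an integral of the gradient. *)
Lemma potential_le (W W' : R -> R) (x : 'rV[R]_d) :
  (forall s : R, is_derive s 1 W (W' s)) ->
  (forall s, 0 <= s -> b * s / (1 + s ^+ 2) `^ (1 - alpha / 2) <= W' s) ->
  V x <= V 0 + (W (enorm x) - W 0).
Proof.
move=> dW W'ge.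
set rho := enorm x; have rho0 : 0 <= rho by exact: enorm_ge0.
pose g (t : R) : R := V (t *: x) - W (t * rho).
pose g' (t : R) : R := 'D_x V (t *: x) - rho * W' (t * rho).
have dWr (t : R) : is_derive t 1 (fun u : R => W (u * rho)) (rho * W' (t * rho)).
  have dl : is_derive t 1 (fun u : R => u * rho) rho.
    by apply: is_derive_eq; rewrite /GRing.scale/= mulr1 mulr0 add0r.
  by rewrite [rho * _]mulrC; exact: is_derive1_comp.
have dg (t : R) : is_derive t 1 g (g' t).
  by apply: is_deriveB; exact: is_derive_ray.
have cg : {within `[0, 1], continuous g}.
  apply: derivable_within_continuous => t _.
  by have [] := dg t.
have [c /[!in_itv]/= /andP[c0 c1]] := MVT ltr01 (fun t _ => dg t) cg.
rewrite subr0 mulr1 /g scale1r mul1r scale0r mul0r -/rho => E.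
suff : g' c <= 0 by move: E; lra.
rewrite /g' subr_le0 derive_grad.
rewrite (le_trans (dotprod_le_enorm _ _))// -/rho ler_wpM2l//.
have cr : enorm (c *: x) = c * rho by rewrite enormZ gtr0_norm.
rewrite (le_trans (gradV _))// cr.
by apply: W'ge; rewrite mulr_ge0// ltW.
Qed.

Let one_sqr_gt0 (s : R) : 0 < 1 + s ^+ 2.
Proof. by rewrite ltr_pwDl// sqr_ge0. Qed.

Let is_derive_1sqr (s : R) : is_derive s 1 (fun u : R => 1 + u ^+ 2) (2 * s).
Proof.
apply: is_derive_eq; rewrite /GRing.scale/=.
by ring.
Qed.

Lemma potential_le_powR x : 0 < alpha ->
  V x <= V 0 + b / alpha * (1 + enorm x ^+ 2) `^ (alpha / 2).
Proof.
move=> a0.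
have ba : 0 <= b / alpha by rewrite divr_ge0// ltW.
pose W (s : R) := b / alpha * (1 + s ^+ 2) `^ (alpha / 2).
pose W' (s : R) := b * s * (1 + s ^+ 2) `^ (alpha / 2 - 1).
have dW (s : R) : is_derive s 1 W (W' s).
  have dp := @is_derive1_powR R (alpha / 2) _ (one_sqr_gt0 s).
  have dc := is_derive1_comp (dp : is_derive ((fun u : R => 1 + u ^+ 2) s) _ _ _)
    (is_derive_1sqr s).
  apply: (is_derive_eq (is_deriveZ (b / alpha) dc)).
  by rewrite /W' /GRing.scale/=; field; rewrite gt_eqF.
apply: (le_trans (potential_le x dW _)).
  move=> s s0; rewrite /W' ler_wpM2l//; first by rewrite mulr_ge0// ltW.
  by rewrite -powRN opprB.
by rewrite lerD2l gerBl /W mulr_ge0// powR_ge0.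
Qed.

Lemma potential_le_ln x : alpha = 0 ->
  V x <= V 0 + b / 2 * ln (1 + enorm x ^+ 2).
Proof.
move=> a0.
pose W (s : R) := b / 2 * ln (1 + s ^+ 2).
pose W' (s : R) := b * s / (1 + s ^+ 2).
have dW (s : R) : is_derive s 1 W (W' s).
  have dp := @is_derive1_ln R _ (one_sqr_gt0 s).
  have dc := is_derive1_comp (dp : is_derive ((fun u : R => 1 + u ^+ 2) s) _ _ _)
    (is_derive_1sqr s).
  apply: (is_derive_eq (is_deriveZ (b / 2) dc)).
  by rewrite /W' /GRing.scale/=; field; rewrite gt_eqF.
apply: (le_trans (potential_le x dW _)).
  by move=> s s0; rewrite a0 mul0r subr0 powRr1// ltW.
by rewrite /W expr0n/= addr0 ln1 mulr0 subr0.
Qed.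

End potential.

(** Read off the definition of the integral as a supremum over simple functions, so that it covers
    [expR (- V x)], whose measurability for the coordinate sigma-algebra has not been
    established. *)
Lemma ge0_le_integral_nonmeas {R : realType} {disp : measure_display}
    {T : measurableType disp} (mu : {measure set T -> \bar R}) (D : set T)
    (f1 f2 : T -> \bar R) :
  (forall x, D x -> 0 <= f1 x)%E -> (forall x, D x -> f1 x <= f2 x)%E ->
  (\int[mu]_(x in D) f1 x <= \int[mu]_(x in D) f2 x)%E.
Proof.
move=> f10 f12; rewrite !(integral_mkcond D) !ge0_integralTE.
- apply: le_ereal_sup => _ [h hf <-]; exists h => // x.
  apply: (le_trans (hf x)); rewrite /patch; case: ifPn => //.
  by rewrite inE; exact: f12.
- move=> x; rewrite /patch; case: ifPn => // /set_mem Dx.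
  by rewrite (le_trans (f10 x Dx))// f12.
- by move=> x; rewrite /patch; case: ifPn => // /set_mem /f10.
Qed.

Section box.
Context {R : realType}.

(** A cube fits the iterated construction of [lebesgue_rV]. Every coordinate being at least [r],
    control of a single one keeps the process far from the origin. *)
Definition box (d : nat) (r : R) : set 'rV[R]_d :=
  [set x | forall i, r <= x 0 i <= 2 * r].

Lemma measurable_box d r : measurable (@box d r).
Proof.
have -> : @box d r = \big[setI/setT]_(i < d)
    (fun x : 'rV[R]_d => x 0 i) @^-1` `[r, 2 * r]%classic.
  rewrite -bigcap_seq; apply/seteqP; split => [x h i _|x h i].
    by rewrite /= in_itv/=; exact: h.
  by have := h i (mem_index_enum i); rewrite /= in_itv.
apply: bigsetI_measurable => i _; rewrite -[X in measurable X]setTI.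
exact: measurable_rV_coord.
Qed.

Lemma lebesgue_box d (r : R) : 0 <= r ->
  lebesgue_rV d (box r) = (r ^+ d)%:E :> \bar R.
Proof.
move=> r0; elim: d => [|d IH].
  by rewrite /= /lebesgue_rV diracE mem_set// => -[].
rewrite /= /lebesgue_cons /pushforward.
have -> : @rV_cons R d @^-1` box r = `[r, 2 * r]%classic `*` box r.
  apply/seteqP; split => [[y x]|[y x]] /=.
    move=> h; split => [|i].
      by have := h ord0; rewrite rV_consE0 /= in_itv.
    by have := h (lift ord0 i); rewrite rV_consES.
  rewrite in_itv/= => -[hy hx] i.
  by case: (unliftP ord0 i) => [j|] ->; rewrite ?rV_consE0 ?rV_consES.
transitivity (mule (@lebesgue_measure R `[r, 2 * r]%classic) (lebesgue_rV d (box r))).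
  by apply: product_measure1E => //; exact: measurable_box.
rewrite lebesgue_measure_itv/= lte_fin.
case: ltP => [_|r2]; first by rewrite IH -EFinB -EFinM exprS; congr (_ * _)%:E; ring.
rewrite mul0e; have -> : r = 0 by lra.
by rewrite expr0n.
Qed.

Lemma enorm_box d (r : R) x : (0 < d)%N -> 0 <= r -> box r x ->
  r <= @enorm R d x <= 2 * d%:R * r.
Proof.
case: d x => // d x _ r0 bx; apply/andP; split.
  have /andP[rx _] := bx ord0.
  by rewrite (le_trans rx)// (le_trans (ler_norm _))// coord_le_enorm.
rewrite -mulrA mulrCA; apply: enorm_le; first by rewrite mulr_ge0.
by move=> i; have /andP[rx x2r] := bx i; rewrite ger0_norm// (le_trans r0).
Qed.

End box.

Section box_mass.
Context {R : realType} {d : nat}.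
Variables (b alpha : R) (V : 'rV[R]_d -> R) (pi : probability 'rV[R]_d R).
Hypothesis d0 : (0 < d)%N.
Hypothesis b0 : 0 < b.
Hypothesis dV : forall x, differentiable V x.
Hypothesis gibbsV : gibbs V pi.
Hypothesis gradV : forall x, enorm (grad V x) <=
  b * enorm x / (1 + enorm x ^+ 2) `^ (1 - alpha / 2).

Let box_mass_ge : exists2 c : R, 0 < c & forall (r m : R), 0 <= r ->
  (forall x, box r x -> V x <= V 0 + m) ->
  ((c * expR (- m) * r ^+ d)%:E <= pi (box r))%E.
Proof.
case: gibbsV => c c0 piE; exists (c * expR (- V 0)).
  by rewrite mulr_gt0// expR_gt0.
move=> r m r0 Vm; rewrite piE; last exact: measurable_box.
rewrite -mulrA -mulrA EFinM lee_pmul2l// mulrA -expRD -opprD.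
apply: (@le_trans _ _ (\int[lebesgue_rV d]_(x in box r) (expR (- (V 0 + m)))%:E)%E).
  rewrite integral_cst//; last exact: measurable_box.
  rewrite [X in (_ <= _ * X)%E](_ : _ = (r ^+ d)%:E); last exact: lebesgue_box.
  by rewrite -EFinM.
apply: ge0_le_integral_nonmeas => x bx; rewrite lee_fin ?expR_ge0//.
by rewrite ler_expR lerN2 Vm.
Qed.

Lemma box_mass_powR : 0 < alpha -> exists K C : R, 0 < K /\
  forall r, 1 <= r -> ((expR (- (K * r `^ alpha + C)))%:E <= pi (box r))%E.
Proof.
move=> a0; have [c c0 hc] := box_mass_ge.
(* On the box [enorm x <= 2 * d * r], so [1 + enorm x ^+ 2 <= D * r ^+ 2] once [1 <= r]. *)
pose D : R := 1 + (2 * d%:R) ^+ 2.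
have D0 : 0 < D by rewrite ltr_pwDl// sqr_ge0.
exists (b / alpha * D `^ (alpha / 2)), (- ln c); split.
  by rewrite mulr_gt0 ?divr_gt0// powR_gt0.
move=> r r1; have r0 : 0 <= r by rewrite (le_trans _ r1).
apply: (le_trans _ (hc r (b / alpha * D `^ (alpha / 2) * r `^ alpha) r0 _)).
  rewrite lee_fin opprD opprK expRD lnK ?posrE// mulrC.
  by rewrite ler_peMr ?exprn_ege1// mulr_ge0 ?expR_ge0// ltW.
move=> x bx; rewrite (le_trans (potential_le_powR b0 dV gradV x a0))// lerD2l.
have ba : 0 <= b / alpha by rewrite divr_ge0// ltW.
rewrite -[leRHS]mulrA; apply: (ler_wpM2l ba).
have -> : r `^ alpha = (r ^+ 2) `^ (alpha / 2).
  by rewrite -powR_mulrn// -powRrM mulrC divfK.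
rewrite -powRM ?sqr_ge0//; last exact: ltW.
apply: ge0_ler_powR; rewrite ?nnegrE ?addr_ge0 ?sqr_ge0//.
- by rewrite divr_ge0// ltW.
- by rewrite mulr_ge0 ?sqr_ge0// ltW.
have /andP[_ xr] := enorm_box d0 r0 bx.
rewrite /D mulrDl mul1r lerD//; first by rewrite exprn_ege1.
by rewrite -exprMn lerXn2r ?nnegrE ?enorm_ge0// ?mulr_ge0.
Qed.

(** Unlike for positive [alpha], the volume [r ^+ d] is kept: it competes with the factor [r^-b]
    coming from the potential, and their product produces [nu = b - d]. *)
Lemma box_mass_ln : alpha = 0 -> exists C : R,
  forall r, 1 <= r -> ((expR (- ((b - d%:R) * ln r + C)))%:E <= pi (box r))%E.
Proof.
move=> a0; have [c c0 hc] := box_mass_ge.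
pose D : R := 1 + (2 * d%:R) ^+ 2.
have D0 : 0 < D by rewrite ltr_pwDl// sqr_ge0.
exists (b / 2 * ln D - ln c).
move=> r r1; have r0 : 0 < r by rewrite (lt_le_trans _ r1).
apply: (le_trans _ (hc r (b / 2 * (ln D + 2 * ln r)) (ltW r0) _)).
  rewrite lee_fin.
  set m := b / 2 * (ln D + 2 * ln r).
  have -> : c * expR (- m) * r ^+ d = expR (ln c - m + d%:R * ln r).
    by rewrite !expRD expRM_natl !lnK ?posrE.
  by rewrite ler_expR /m; lra.
move=> x bx; rewrite (le_trans (potential_le_ln dV gradV x a0))// lerD2l.
have b2 : 0 <= b / 2 by rewrite divr_ge0// ltW.
apply: (ler_wpM2l b2).
have -> : 2 * ln r = ln (r ^+ 2) by rewrite lnXn// mulr_natl.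
rewrite -lnM ?posrE ?exprn_gt0// ler_ln ?posrE ?mulr_gt0 ?exprn_gt0//.
  have /andP[_ xr] := enorm_box d0 (ltW r0) bx.
  rewrite /D mulrDl mul1r lerD//; first by rewrite exprn_ege1.
  by rewrite -exprMn lerXn2r ?nnegrE ?enorm_ge0// ?mulr_ge0// ltW.
by rewrite ltr_pwDl// sqr_ge0.
Qed.

End box_mass.

(** * Divergences *)

Section renyi_mass.
Context {R : realType} {disp : measure_display} {T : measurableType disp}.
Variables (pi : probability T R) (q : R).
Hypothesis q1 : 1 < q.

(** Below [lam] the second term suffices; above it, [y = y^(1-q) * y^q] and [y^(1-q) <= lam^(1-q)]
    because [1 - q < 0]. *)
Let le_powR_add (lam y : R) : 0 < lam -> 0 <= y ->
  y <= lam `^ (1 - q) * y `^ q + lam.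
Proof.
move=> lam0 y0; have [ylam|lamy] := leP y lam.
  by rewrite (le_trans ylam)// lerDr mulr_ge0// powR_ge0.
have y0' : 0 < y by rewrite (lt_trans lam0).
rewrite -[leLHS]addr0 lerD//; last exact: ltW.
have {1}-> : y = y `^ (1 - q) * y `^ q.
  rewrite -powRD ?subrK ?powRr1//.
  by rewrite (gt_eqF y0')/= implybT.
apply: (ler_wpM2r (powR_ge0 _ _)).
rewrite -(opprB q 1) !powRN lef_pV2 ?posrE ?powR_gt0//.
by apply: ge0_ler_powR; rewrite ?nnegrE ?subr_ge0; apply: ltW.
Qed.

Lemma renyi_density_moment (mu : probability T R) : (renyi q%:E mu pi <= 1)%E ->
  mu `<< pi /\
  (\int[pi]_x (`|density mu pi x| `^ q) <= (expR (q - 1))%:E)%E.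
Proof.
have q0 : 0 < q by rewrite (lt_trans ltr01).
rewrite /renyi; case: asboolP => // mupi; rewrite (gt_eqF q1) => h; split => //.
move: h; rewrite unlock -poweRrM mulVf ?gt_eqF// poweRe1; last first.
  by apply: integral_ge0 => x _; exact: poweR_ge0.
set I := (\int[pi]_x _)%E => h.
have I0 : (0 <= I)%E by apply: integral_ge0 => x _; exact: poweR_ge0.
rewrite -(@lneK _ I); last by rewrite in_itv/= I0 leey.
rewrite -[leRHS]/(expeR (q - 1)%:E) lee_expeR.
move: h; rewrite muleC lee_pdivrMr ?subr_gt0// mul1e.
by [].
Qed.

(** The density is cut at height [lam]: the high part is paid by its [q]-th moment, the low part by
    [pi A]. The height stays free, to be matched later with the mass of [A]. *)
Lemma renyi_le_mass (mu : probability T R) (A : set T) (lam : R) :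
  (renyi q%:E mu pi <= 1)%E -> measurable A -> 0 < lam ->
  (mu A <= (lam `^ (1 - q) * expR (q - 1))%:E + lam%:E * pi A)%E.
Proof.
move=> /renyi_density_moment[mupi Iq] mA lam0.
set f := density mu pi in Iq *.
have fint : pi.-integrable setT f by exact: Radon_Nikodym_integrable.
have mf : measurable_fun setT f by exact: measurable_int fint.
have mfq : measurable_fun setT (fun x => `|f x| `^ q)%E.
  apply: (measurableT_comp (measurable_poweR _)).
  exact: measurableT_comp.
have -> : mu A = (\int[pi]_(x in A) f x)%E.
  exact: (Radon_Nikodym_integral (nu := charge_of_finite_measure mu)).
apply: (@le_trans _ _ (\int[pi]_(x in A) `|f x|)%E).
  apply: (le_trans (lee_abs _)); apply: le_abse_integral => //.
  exact: measurable_funTS.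
apply: (@le_trans _ _ (\int[pi]_(x in A)
    ((lam `^ (1 - q))%:E * `|f x| `^ q + lam%:E))%E).
  apply: ge0_le_integral_nonmeas => // x _.
  have : f x \is a fin_num.
    exact: (Radon_Nikodym_fin_num (nu := charge_of_finite_measure mu)).
  case: (f x) => // y _.
  by rewrite abse_EFin poweR_EFin -EFinM -EFinD lee_fin le_powR_add.
have ml : measurable_fun setT (fun x => (lam `^ (1 - q))%:E * `|f x| `^ q)%E.
  exact: measurable_funeM.
rewrite ge0_integralD//; first last.
- by move=> x _; rewrite lee_fin ltW.
- exact: measurable_funTS.
- by move=> x _; rewrite mule_ge0 ?poweR_ge0// lee_fin powR_ge0.
rewrite integral_cst// leeD2r// ge0_integralZl//; first last.
- by rewrite lee_fin powR_ge0.
- by move=> x _; rewrite poweR_ge0.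
- exact: measurable_funTS.
rewrite EFinM lee_wpmul2l ?lee_fin ?powR_ge0//.
apply: le_trans Iq; apply: ge0_subset_integral => //.
by move=> x _; rewrite poweR_ge0.
Qed.

End renyi_mass.

(** * Tails of laws close to the target in Renyi divergence *)

Section renyi_tail.
Context {R : realType} {d : nat}.
Variables (pi : probability 'rV[R]_d R).

Definition far (r : R) : set 'rV[R]_d := [set x | r <= enorm x].

Lemma measurable_far r : measurable (far r).
Proof.
rewrite (_ : far r = @enorm R d @^-1` `[r, +oo[%classic).
  by rewrite -[X in measurable X]setTI; exact: measurable_enorm.
by apply/seteqP; split => x /=; rewrite in_itv/= andbT.
Qed.

(** Markov's inequality restricted to the far region: the right-hand side is the tail of a
    convergent integral, so it becomes small instead of merely staying bounded. *)
Lemma moment_tail (s : R) : 0 < s ->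
  (\int[pi]_x (enorm x `^ s)%:E < +oo)%E -> forall eta : R, 0 < eta ->
  exists2 r0 : R, 0 < r0 & forall r, r0 <= r ->
    ((r `^ s)%:E * pi (far r) <= eta%:E)%E.
Proof.
move=> s0 ioo eta eta0.
pose g (x : 'rV[R]_d) : \bar R := (enorm x `^ s)%:E.
have mg : measurable_fun setT g.
  apply/measurable_EFinP.
  exact: (measurableT_comp (measurable_powR _) measurable_enorm).
have g0 x : (0 <= g x)%E by rewrite lee_fin powR_ge0.
have ig : pi.-integrable setT g.
  apply/integrableP; split => //.
  by under eq_integral do rewrite gee0_abs//.
pose G (n : nat) := ~` far n%:R.
have mG n : measurable (G n) by apply: measurableC; exact: measurable_far.
have UG : \bigcup_n G n = setT.
  apply/seteqP; split => // x _; exists (Num.truncn (enorm x)).+1 => //=.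
  by rewrite /G /far/=; apply/negP; rewrite -ltNge truncnS_gt.
have := @ge0_nondecreasing_set_cvg_integral _ _ _ G g pi.
rewrite UG => cv.
have {}cv : (\int[pi]_(x in G i) g x @[i --> \oo] --> \int[pi]_x g x)%E.
  apply: cv => //.
  - apply/nondecreasing_seqP => n; apply/subsetPset => x.
    rewrite /G /far/= => /negP nx; apply/negP; move: nx.
    by rewrite -!ltNge => /lt_trans; apply; rewrite ltr_nat.
  - by move=> i; exact: measurable_funTS.
have fin_g : (\int[pi]_x g x)%E \is a fin_num by exact: integrable_fin_num.
have [n /= hn] : exists n, ((\int[pi]_x g x)%E - eta%:E < \int[pi]_(x in G n) g x)%E.
  have : ((\int[pi]_x g x)%E - eta%:E < \int[pi]_x g x)%E.
    by rewrite -(fineK fin_g) -EFinB lte_fin ltrBlDr ltrDl.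
  apply: contraPP => /forallNP hn; apply/negP; rewrite -leNgt.
  by apply: (cvge_le _ cv); apply: nearW => n; rewrite leNgt; apply/negP.
(* The successor keeps the threshold positive when [n] is 0. *)
exists n.+1%:R => // r nr.
have r0 : 0 < r by rewrite (lt_le_trans _ nr).
apply: (@le_trans _ _ (\int[pi]_(x in far r) g x)%E).
  rewrite -integral_cst; last exact: measurable_far.
  apply: ge0_le_integral_nonmeas => x; first by rewrite lee_fin powR_ge0.
  rewrite /far/= => rx; rewrite lee_fin; apply: ge0_ler_powR => //.
  - exact: ltW.
  - by rewrite nnegrE ltW.
  - by rewrite nnegrE enorm_ge0.
apply: (@le_trans _ _ (\int[pi]_(x in far n%:R) g x)%E).
  apply: ge0_subset_integral => //; try exact: measurable_far.
  - exact: measurable_funTS.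
  - by move=> x; rewrite /far/=; apply: le_trans; rewrite (le_trans _ nr)// ler_nat.
have split_g : (\int[pi]_x g x =
    \int[pi]_(x in G n) g x + \int[pi]_(x in far n%:R) g x)%E.
  rewrite -[X in (\int[_]_(_ in X) _ = _)%E](setvU (far n%:R)).
  apply: (ge0_integral_setU pi (mG n) (measurable_far _)) => //.
  - by rewrite setvU.
  - by rewrite disj_set2E /G setICl.
have fG : (\int[pi]_(x in G n) g x)%E \is a fin_num.
  apply: integrable_fin_num => //; exact: integrableS ig.
have fF : (\int[pi]_(x in far n%:R) g x)%E \is a fin_num.
  apply: integrable_fin_num => //; first exact: measurable_far.
  by apply: integrableS ig => //; exact: measurable_far.
move: hn; rewrite split_g -(fineK fG) -(fineK fF) -!EFinD lte_fin lee_fin.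
by lra.
Qed.

(** With the height [lam] proportional to [r^(2/(q-1))], the first term of [renyi_le_mass] scales as
    [r^-2], and so does the second by the moment of order [2q/(q-1) = 2/(q-1) + 2]. The threshold
    [r0] does not depend on [mu]. *)
Lemma renyi_tail (q : R) : 1 < q ->
  (\int[pi]_x (enorm x `^ (2 * q / (q - 1)))%:E < +oo)%E ->
  forall eps : R, 0 < eps -> exists2 r0 : R, 0 < r0 &
  forall r, r0 <= r -> forall mu : probability 'rV[R]_d R,
    (renyi q%:E mu pi <= 1)%E -> (mu (far r) <= (eps / r ^+ 2)%:E)%E.
Proof.
move=> q1 ioo eps eps0.
have q10 : 0 < q - 1 by rewrite subr_gt0.
pose M : R := expR (q - 1).
have M0 : 0 < M by exact: expR_gt0.
(* The solution of [kap^(1-q) * M = eps / 2]: the first term gets half of [eps], and the moment tail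
   is then made small enough for the other half. *)
pose kap : R := (2 * M / eps) `^ (q - 1)^-1.
have kap0 : 0 < kap by rewrite powR_gt0// divr_gt0// mulr_gt0.
have kapE : kap `^ (1 - q) * M = eps / 2.
  rewrite /kap -powRrM -(opprB q) mulrN mulVf ?gt_eqF// powRN powRr1.
    by rewrite invf_div; field; rewrite gt_eqF.
  by rewrite divr_ge0 ?mulr_ge0// ltW.
have s0 : 0 < 2 * q / (q - 1).
  by rewrite divr_gt0// mulr_gt0// (lt_trans ltr01).
have [|r0 r00 hr0] := moment_tail s0 ioo (eta := eps / 2 / kap).
  by rewrite !divr_gt0.
exists r0 => // r r0r mu hmu.
have r0' : 0 < r by rewrite (lt_le_trans r00).
pose lam := kap * r `^ (2 / (q - 1)).
have lam0 : 0 < lam by rewrite mulr_gt0// powR_gt0.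
apply: (le_trans (renyi_le_mass q1 hmu (measurable_far r) lam0)).
have E1 : lam `^ (1 - q) * expR (q - 1) = eps / 2 / r ^+ 2.
  rewrite /lam powRM ?powR_ge0//.
  rewrite mulrAC kapE; congr (_ * _).
  rewrite -powRrM -(opprB q) mulrN divfK ?gt_eqF// powRN.
  by rewrite -powR_mulrn// ltW.
rewrite E1.
have pf : pi (far r) = (fine (pi (far r)))%:E.
  by rewrite fineK// fin_num_measure//; exact: measurable_far.
have := hr0 r r0r; rewrite pf -EFinM lee_fin => h.
rewrite -EFinM -EFinD lee_fin.
have E2 : r `^ (2 * q / (q - 1)) = r `^ (2 / (q - 1)) * r ^+ 2.
  rewrite -powR_mulrn; last exact: ltW.
  rewrite -powRD; last by rewrite (gt_eqF r0')/= implybT.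
  by congr (_ `^ _); field; rewrite gt_eqF.
have : lam * fine (pi (far r)) <= eps / 2 / r ^+ 2.
  rewrite ler_pdivlMr ?exprn_gt0//.
  move: h; rewrite E2 ler_pdivlMr// /lam => h.
  by rewrite (le_trans _ h)// le_eqVlt; apply/orP; left; apply/eqP; ring.
rewrite (_ : eps / r ^+ 2 = eps / 2 / r ^+ 2 + eps / 2 / r ^+ 2); first by lra.
by rewrite -mulrDl -splitr.
Qed.

End renyi_tail.

(** * Initial laws *)

Section mixture.
Context {R : realType} {disp : measure_display} {T : measurableType disp}.
Variables (pi : probability T R) (D : set T) (w : R).
Hypothesis mD : measurable D.
Hypothesis w01 : 0 <= w <= 1.

Let p := fine (pi D).
Hypothesis p0 : 0 < p.

Let piD : pi D = p%:E.
Proof. by rewrite /p fineK// fin_num_measure. Qed.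

Let p1 : p <= 1.
Proof. by rewrite -lee_fin -piD; exact: probability_le1. Qed.

Let w0 : 0 <= w. Proof. by case/andP: w01. Qed.
Let w1 : 0 <= 1 - w. Proof. by rewrite subr_ge0; case/andP: w01. Qed.
Let wp0 : 0 <= w / p. Proof. by rewrite divr_ge0// ltW. Qed.

(** With weight [1 - w] the target, with weight [w] the target conditioned on [D]. The value [w = 1]
    serves [alpha < 2], a small [w] serves [alpha = 2]. *)
Let mix : {measure set T -> \bar R} :=
  measure_add (mscale (NngNum w1) pi) (mscale (NngNum wp0) (mrestr pi mD)).

Let mixE A : mix A = ((1 - w)%:E * pi A + (w / p)%:E * pi (A `&` D))%E.
Proof. exact: measure_addE. Qed.

Let mixT : mix setT = 1%E.
Proof.
rewrite mixE probability_setT mule1 setTI piD -EFinM -EFinD.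
by congr EFin; field; rewrite gt_eqF.
Qed.

(** The mass is already 1 by [mixT]; normalizing only packages the measure as a probability. *)
Definition mixture : probability T R := mnormalize mix pi.

Lemma mixtureE A :
  mixture A = ((1 - w)%:E * pi A + (w / p)%:E * pi (A `&` D))%E.
Proof.
rewrite -mixE; have : mnormalize mix pi A = mix A.
  rewrite /mnormalize mixT ifF; last by rewrite eqe oner_eq0.
  by rewrite invr1 mule1.
exact.
Qed.

Lemma mixture_le : (w%:E <= mixture D)%E.
Proof.
rewrite mixtureE setIid piD -!EFinM -EFinD lee_fin divfK ?gt_eqF//.
by rewrite lerDr mulr_ge0// ltW.
Qed.

Let g (x : T) : R := (1 - w) + w / p * \1_D x.

Let g0 x : 0 <= g x.
Proof. by rewrite addr_ge0// mulr_ge0. Qed.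

Let mg : measurable_fun setT g.
Proof. by apply: measurable_funD => //; apply: measurable_funM. Qed.

Let gDE x : D x -> g x = (1 - w) + w / p.
Proof. by move=> Dx; rewrite /g indicE mem_set// mulr1. Qed.

Let gNDE x : ~ D x -> g x = 1 - w.
Proof. by move=> Dx; rewrite /g indicE memNset// mulr0 addr0. Qed.

Let g_le x : g x <= p^-1.
Proof.
have p1' : 1 <= p^-1 by rewrite invf_ge1.
have [Dx|nDx] := pselect (D x).
  rewrite gDE// mulrC.
  have -> : p^-1 * w = p^-1 - (1 - w) * p^-1 by ring.
  by rewrite addrCA gerDl subr_le0 ler_peMr.
rewrite gNDE// (le_trans _ p1')//.
by rewrite gerBl.
Qed.

Let mixture_density A : measurable A -> mixture A = (\int[pi]_(x in A) (g x)%:E)%E.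
Proof.
move=> mA; rewrite mixtureE /g.
under eq_integral do rewrite EFinD EFinM.
rewrite ge0_integralD//; first last.
- by apply: measurable_funeM; apply: measurable_funTS; exact/measurable_EFinP.
- by move=> x _; rewrite mule_ge0// lee_fin.
rewrite integral_cst// ge0_integralZl//; last first.
  by apply: measurable_funTS; exact/measurable_EFinP.
by rewrite integral_indic// setIC.
Qed.

Let ig : pi.-integrable setT (EFin \o g).
Proof.
apply: (bounded_integrable pi mg (M := p^-1)) => x.
by rewrite ger0_norm.
Qed.

Lemma mixture_dominated : mixture `<< pi.
Proof.
apply/null_content_dominatesP => A mA piA; rewrite mixture_density//.
apply: null_set_integral => //.
by apply: measurable_funTS; exact: measurable_int ig.
Qed.

Lemma density_mixture : ae_eq pi setT (density mixture pi) (EFin \o g).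
Proof.
apply: integral_ae_eq => //.
- apply: (Radon_Nikodym_integrable (nu := charge_of_finite_measure mixture)).
  exact: mixture_dominated.
- exact/measurable_EFinP.
- move=> A _ mA; rewrite -mixture_density//.
  apply/esym.
  apply: (Radon_Nikodym_integral (nu := charge_of_finite_measure mixture)) => //.
  exact: mixture_dominated.
Qed.

Let mf : measurable_fun setT (density mixture pi).
Proof.
apply: (measurable_int pi).
apply: (Radon_Nikodym_integrable (nu := charge_of_finite_measure mixture)).
exact: mixture_dominated.
Qed.

Let mlne : measurable_fun setT (fun x => lne (density mixture pi x)).
Proof.
pose fr x := fine (density mixture pi x).
have mfr : measurable_fun setT fr by exact: measurableT_comp mf.
rewrite (_ : (fun x => _) =
  fun x => if fr x <= 0 then -oo%E else (ln (fr x))%:E); last first.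
  apply/funext => x; rewrite /fr.
  have : density mixture pi x \is a fin_num.
    apply: (Radon_Nikodym_fin_num (nu := charge_of_finite_measure mixture)).
    exact: mixture_dominated.
  by case: (density mixture pi x).
apply: measurable_fun_ifT.
- exact: measurable_fun_ler.
- exact: measurable_cst.
- by apply/measurable_EFinP; exact: measurableT_comp.
Qed.

(** Off [D] the density is [1 - w <= 1], so its logarithm can be bounded by 0; on [D] the logarithm
    is at most [- ln p], the density being at most [p^-1]. *)
Lemma KL_mixture : (KL mixture pi <= (- ln p)%:E * mixture D)%E.
Proof.
have lnp : 0 <= - ln p by rewrite oppr_ge0 ln_le0.
rewrite /KL asboolT; last exact: mixture_dominated.
rewrite integralE.
apply: (@le_trans _ _ (\int[mixture]_x ((fun x => lne (density mixture pi x))^\+ x))%E).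
  by apply: geeDl; rewrite oppe_le0; apply: integral_ge0.
apply: (@le_trans _ _ (\int[mixture]_x ((- ln p)%:E * (\1_D x)%:E))%E).
  apply: ae_ge0_le_integral => //.
  - exact: measurable_funepos.
  - by move=> x _; rewrite mule_ge0// lee_fin.
  - by apply: measurable_funeM; exact/measurable_EFinP.
  - have : \forall x \ae mixture, density mixture pi x = (g x)%:E.
      have [N [mN piN sN]] := density_mixture; exists N; split => //.
        have /null_content_dominatesP := mixture_dominated.
        exact.
      by move=> x /= nx; apply: sN => /= h; apply: nx; exact: h.
    apply: filterS => x fx _; rewrite funeposE fx.
    have [Dx|nDx] := pselect (D x).
      rewrite indicE mem_set// mule1 ge_max lee_fin lnp andbT.
      have [gx0|gx0] := eqVneq (g x) 0; first by rewrite gx0 le0_lneNy ?leNye.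
      have gx0' : 0 < g x by rewrite lt_neqAle eq_sym gx0 g0.
      by rewrite lne_EFin// lee_fin -lnV// ler_ln ?posrE ?invr_gt0.
    rewrite indicE memNset// mule0 ge_max lexx andbT lne_le0 lee_fin.
    by rewrite gNDE// gerBl.
rewrite ge0_integralZl//; first by rewrite integral_indic// setIT.
  exact/measurable_EFinP.
Qed.

Hypothesis wE : w = 1.

Let gE x : g x = p^-1 * \1_D x.
Proof. by rewrite /g wE subrr add0r mul1r. Qed.

(** For [w = 1] the density is [p^-1] on [D] and 0 elsewhere, so the same bound serves all orders at
    once: this is why one initial law handles every [q']. *)
Lemma renyi_mixture (q : \bar R) : (1 <= q)%E ->
  (renyi q mixture pi <= (- ln p)%:E)%E.
Proof.
have lnp : 0 <= - ln p by rewrite oppr_ge0 ln_le0.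
have KLle : (KL mixture pi <= (- ln p)%:E)%E.
  apply: (le_trans KL_mixture); rewrite -[leRHS]mule1 lee_wpmul2l ?lee_fin//.
  exact: probability_le1.
move=> q1; rewrite /renyi asboolT; last exact: mixture_dominated.
case: q q1 => [r| |//].
- rewrite lee_fin => r1; case: eqP => [//|/eqP rn1].
  have {}r1 : 1 < r by rewrite lt_neqAle eq_sym rn1.
  have r0 : 0 < r by rewrite (lt_trans ltr01).
  rewrite unlock -poweRrM mulVf ?gt_eqF// poweRe1; last first.
    by apply: integral_ge0 => x _; exact: poweR_ge0.
  have -> : (\int[pi]_x `|density mixture pi x| `^ r = (p^-1 `^ (r - 1))%:E)%E.
    transitivity (\int[pi]_x ((p^-1 `^ r)%:E * (\1_D x)%:E))%E.
      apply: ge0_ae_eq_integral => //.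
      + apply: (measurableT_comp (measurable_poweR _)).
        exact: measurableT_comp.
      + by apply: measurable_funeM; exact/measurable_EFinP.
      + by move=> x _; rewrite poweR_ge0.
      + by move=> x _; rewrite mule_ge0// lee_fin powR_ge0.
      + apply: filterS density_mixture => x /[apply] ->.
        have -> : `|(EFin \o g) x|%E = (`|p^-1 * \1_D x|)%:E by rewrite /= gE.
        have pV0 : 0 <= p^-1 by rewrite invr_ge0 ltW.
        rewrite poweR_EFin normrM powRM// (ger0_norm pV0).
        rewrite indicE EFinM; congr (_ * _)%E.
        by case: (x \in D); rewrite ?normr1 ?powR1 ?normr0 ?powR0 ?gt_eqF.
    rewrite ge0_integralZl//; last 2 first.
    + exact/measurable_EFinP.
    + by rewrite lee_fin powR_ge0.
    rewrite integral_indic// setIT.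
    rewrite [X in (_ * X)%E](_ : _ = p%:E); last exact: piD.
    rewrite -EFinM; congr EFin.
    rewrite powRB// ?powRr1 ?invr_ge0 ?(ltW p0)//; first by rewrite invrK.
    by rewrite gt_eqF ?implybT// invr_gt0.
  rewrite lne_EFin ?powR_gt0 ?invr_gt0// ln_powR lnV ?posrE// -EFinM.
  by rewrite mulrA mulVf ?mul1r// subr_eq0.
- move=> _; rewrite unlock; case: ifP => _; last by rewrite le0_lneNy ?leNye.
  have ess : (ess_sup pi (abse \o density mixture pi) <= (p^-1)%:E)%E.
    apply/ess_supP; apply: filterS density_mixture => x /(_ I)/= ->.
    by rewrite lee_fin ger0_norm.
  have [e0|e0] := leP (ess_sup pi (abse \o density mixture pi)) 0%E.
    by rewrite (le0_lneNy e0) leNye.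
  rewrite -lnV ?posrE// -lne_EFin ?invr_gt0// lee_lne//.
    by rewrite in_itv/= leey ltW.
  by rewrite in_itv/= leey lee_fin invr_ge0 ltW.
Qed.

End mixture.

Section initial_laws.
Context {R : realType} {disp : measure_display} {T : measurableType disp}.
Variables (pi : probability T R) (D : set T) (Delta : R).
Hypothesis mD : measurable D.
Hypothesis hD : ((expR (- Delta))%:E <= pi D)%E.

Let p0 : 0 < fine (pi D).
Proof.
rewrite (lt_le_trans (expR_gt0 (- Delta)))// -lee_fin fineK//.
exact: fin_num_measure.
Qed.

Let lnp : - ln (fine (pi D)) <= Delta.
Proof.
rewrite lerNl -ler_expR lnK ?posrE// -lee_fin fineK//.
exact: fin_num_measure.
Qed.

Lemma conditioned_law : exists2 mu0 : probability T R, mu0 D = 1%E &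
  forall q, (1 <= q)%E -> (renyi q mu0 pi <= Delta%:E)%E.
Proof.
have w01 : 0 <= (1 : R) <= 1 by rewrite ler01 lexx.
exists (mixture mD w01 p0).
  by apply/eqP; rewrite eq_le mixture_le andbT; exact: probability_le1.
move=> q q1; apply: (le_trans (renyi_mixture mD w01 p0 erefl q1)).
by rewrite lee_fin.
Qed.

(** [KL_mixture] leaves [- ln p * ((1 - w) * p + w)]: the term in [w] costs at most [w * Delta], the
    other at most [- p * ln p <= 1] however small [p] is. *)
Lemma mixed_law (w : R) : 0 <= w <= 1 ->
  exists2 mu0 : probability T R, (w%:E <= mu0 D)%E &
    (KL mu0 pi <= (w * Delta + 1)%:E)%E.
Proof.
move=> w01; exists (mixture mD w01 p0); first exact: mixture_le.
apply: (le_trans (KL_mixture mD w01 p0)).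
rewrite mixtureE setIid; move: p0 lnp; set p := fine (pi D) => p0' lnp'.
have -> : pi D = p%:E by rewrite /p fineK// fin_num_measure.
rewrite -[leLHS]/((- ln p * ((1 - w) * p + w / p * p))%:E) lee_fin divfK ?gt_eqF//.
have /andP[w0 w1] := w01.
have p1 : p <= 1 by rewrite -lee_fin /p fineK ?fin_num_measure// probability_le1.
have lnp0 : 0 <= - ln p by rewrite oppr_ge0 ln_le0.
have lnpp : - ln p * p <= 1.
  rewrite -lnV ?posrE// -ler_pdivlMr// mul1r ltW// ln_sublinear// invr_gt0//.
rewrite mulrDr addrC lerD//.
  by rewrite mulrC ler_wpM2l.
rewrite mulrCA (le_trans _ lnpp)//; apply: ler_piMl; last by rewrite gerBl.
by rewrite mulr_ge0// ltW.
Qed.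

End initial_laws.

(** * Paths *)

Section shell.
Context {R : realType} {d : nat}.
Variables (b alpha : R) (V : 'rV[R]_d -> R).
Hypothesis b0 : 0 < b.
Hypothesis alpha2 : 0 <= alpha <= 2.
Hypothesis gradV : forall x, enorm (grad V x) <=
  b * enorm x / (1 + enorm x ^+ 2) `^ (1 - alpha / 2).

(** The numerator is at most [3 b d r] and the denominator at least [r^(2-alpha) / 4], whence 12.
    The exponent [e] lies between 0 and 1, which gives both the monotonicity and [4^-e >= 4^-1]. *)
Lemma grad_shell (r : R) x i : 0 < r -> r / 2 <= enorm x <= 3 * d%:R * r ->
  `|grad V x 0 i| <= 12 * b * d%:R * r `^ (alpha - 1).
Proof.
move=> r0 /andP[rx xr]; have /andP[a0 a2] := alpha2.
apply: (le_trans (coord_le_enorm _ _)); apply: (le_trans (gradV x)).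
set e := 1 - alpha / 2; have e0 : 0 <= e by rewrite /e; lra.
have e1 : e <= 1 by rewrite /e; lra.
have xn0 : 0 <= enorm x by exact: enorm_ge0.
have low : r `^ (2 - alpha) / 4 <= (1 + enorm x ^+ 2) `^ e.
  apply: (@le_trans _ _ ((r ^+ 2 / 4) `^ e)); last first.
    apply: ge0_ler_powR => //; rewrite ?nnegrE.
    - by rewrite divr_ge0// sqr_ge0.
    - by rewrite addr_ge0// sqr_ge0.
    - have : (r / 2) ^+ 2 <= enorm x ^+ 2.
        by rewrite lerXn2r ?nnegrE// divr_ge0// ltW.
      by rewrite expr_div_n; lra.
  rewrite powRM ?sqr_ge0//.
  have -> : (r ^+ 2) `^ e = r `^ (2 - alpha).
    rewrite -powR_mulrn; last exact: ltW.
    by rewrite -powRrM; congr (_ `^ _); rewrite /e; field.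
  apply: (ler_wpM2l (powR_ge0 _ _)).
  rewrite -powR_inv1// -powRrM mulN1r; apply: ler_powR; first by lra.
  by rewrite lerN2.
have p0 : 0 < r `^ (2 - alpha) by rewrite powR_gt0.
rewrite ler_pdivrMr; last by rewrite powR_gt0// ltr_pwDl// sqr_ge0.
apply: (@le_trans _ _ (12 * b * d%:R * r `^ (alpha - 1) * (r `^ (2 - alpha) / 4))).
  have E : r `^ (alpha - 1) * r `^ (2 - alpha) = r.
    rewrite -powRD; last by rewrite (gt_eqF r0)/= implybT.
    by rewrite (_ : _ + _ = 1); [rewrite powRr1// ltW|ring].
  have -> : 12 * b * d%:R * r `^ (alpha - 1) * (r `^ (2 - alpha) / 4) =
      b * (3 * d%:R * (r `^ (alpha - 1) * r `^ (2 - alpha))) by field.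
  by rewrite E; apply: ler_wpM2l => //; exact: ltW.
by apply: ler_wpM2l => //; rewrite !mulr_ge0// ?powR_ge0// ltW.
Qed.

End shell.

Section lmc_path.
Context {R : realType} {d : nat}.
Variables (b alpha : R) (V : 'rV[R]_d -> R) (h : R).
Hypothesis d0 : (0 < d)%N.
Hypothesis b0 : 0 < b.
Hypothesis h0 : 0 < h.
Hypothesis alpha2 : 0 <= alpha <= 2.
Hypothesis gradV : forall x, enorm (grad V x) <=
  b * enorm x / (1 + enorm x ^+ 2) `^ (1 - alpha / 2).

(** Strong induction: as long as each coordinate has moved by at most [r / 2], all past positions
    lie in the shell of [grad_shell], so drift and noise move it by at most [r / 4] each. *)
Lemma lmc_path_shell (x xi : nat -> 'rV[R]_d) (r lam : R) (k : nat) :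
  (forall j, x j.+1 = x j - h *: grad V (x j) + Num.sqrt (2 * h) *: xi j) ->
  0 < r -> box r (x 0%N) ->
  (forall j i, (j <= k)%N -> `|(\sum_(l < j) xi l) 0 i| <= lam) ->
  Num.sqrt (2 * h) * lam <= r / 4 ->
  k%:R * h * (12 * b * d%:R * r `^ (alpha - 1)) <= r / 4 ->
  far (r / 2) (x k).
Proof.
move=> xS r0 x0 noise lamr drift.
have xE j : x j = x 0%N - h *: \sum_(l < j) grad V (x l) +
    Num.sqrt (2 * h) *: \sum_(l < j) xi l.
  elim: j => [|j IH]; first by rewrite !big_ord0 !scaler0 subr0 addr0.
  rewrite xS {1}IH !big_ord_recr/= !scalerDr opprD !addrA.
  rewrite -!addrA; congr (_ + (_ + _)); rewrite !addrA; congr (_ + _).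
  by rewrite addrC.
set G := 12 * b * d%:R * r `^ (alpha - 1) in drift.
have G0 : 0 <= G by rewrite !mulr_ge0 ?powR_ge0// ltW.
have sq0 : 0 <= Num.sqrt (2 * h) by exact: sqrtr_ge0.
have step j : (j <= k)%N ->
    (forall l, (l < j)%N -> forall i, `|grad V (x l) 0 i| <= G) ->
    forall i, `|x j 0 i - x 0%N 0 i| <= r / 2.
  move=> jk IH i.
  have -> : x j 0 i - x 0%N 0 i = - (h * \sum_(l < j) grad V (x l) 0 i) +
      Num.sqrt (2 * h) * (\sum_(l < j) xi l) 0 i.
    by rewrite xE !mxE summxE; ring.
  apply: (le_trans (ler_normD _ _)); rewrite normrN !normrM.
  have h1 : `|h| * `|\sum_(l < j) grad V (x l) 0 i| <= k%:R * h * G.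
    rewrite gtr0_norm// mulrAC mulrC; apply: ler_wpM2r; first exact: ltW.
    apply: (le_trans (ler_norm_sum _ _ _)).
    apply: (@le_trans _ _ (\sum_(l < j) G)); first by apply: ler_sum => l _; exact: IH.
    rewrite sumr_const card_ord -[leLHS]mulr_natl; apply: ler_wpM2r => //.
    by rewrite ler_nat.
  have h2 : `|Num.sqrt (2 * h)| * `|(\sum_(l < j) xi l) 0 i| <= r / 4.
    by rewrite ger0_norm// (le_trans _ lamr)// ler_wpM2l// noise.
  by lra.
have shell j : (j <= k)%N -> (forall i, `|x j 0 i - x 0%N 0 i| <= r / 2) ->
    r / 2 <= enorm (x j) <= 3 * d%:R * r.
  move=> jk xj; apply/andP; split.
    have i := Ordinal d0.
    have /andP[rx _] := x0 i; have := xj i; rewrite ler_distl => /andP[xl _].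
    apply: (le_trans _ (coord_le_enorm _ i)); apply: (le_trans _ (ler_norm _)).
    by lra.
  rewrite -mulrA mulrCA; apply: enorm_le; first by rewrite mulr_ge0// ltW.
  move=> i; have /andP[rx xr] := x0 i; have := xj i; rewrite ler_distl => /andP[xl xu].
  by rewrite ler_norml; lra.
have all j : (j <= k)%N -> forall i, `|x j 0 i - x 0%N 0 i| <= r / 2.
  elim/ltn_ind: j => j IH jk; apply: step => // l lj i.
  have lk : (l <= k)%N by rewrite (leq_trans (ltnW lj)).
  by apply: (grad_shell b0 alpha2 gradV) => //; exact: shell lk (IH l lj lk).
by have /andP[] := shell k (leqnn k) (all k (leqnn k)).
Qed.

(** One step multiplies the norm by at least [1 - h * b], positive by assumption, up to a noise
    term. Each [xi j] is a difference of two partial sums, hence the [2 * lam]. *)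
Lemma lmc_path_linear (x xi : nat -> 'rV[R]_d) (r lam : R) (k : nat) :
  alpha = 2 -> h * b < 1 ->
  (forall j, x j.+1 = x j - h *: grad V (x j) + Num.sqrt (2 * h) *: xi j) ->
  0 <= r -> 0 <= lam -> box r (x 0%N) ->
  (forall j i, (j <= k)%N -> `|(\sum_(l < j) xi l) 0 i| <= lam) ->
  far ((1 - h * b) ^+ k * r - k%:R * (Num.sqrt (2 * h) * (d%:R * (2 * lam)))) (x k).
Proof.
move=> a2 hb xS r0 lam0 x0 noise.
set N := Num.sqrt (2 * h) * (d%:R * (2 * lam)).
have N0 : 0 <= N by rewrite !mulr_ge0.
set a := 1 - h * b.
have a0 : 0 < a by rewrite /a; lra.
have a1 : a <= 1 by rewrite /a gerBl mulr_ge0// ltW.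
have lin y : enorm (grad V y) <= b * enorm y.
  by have := gradV y; rewrite a2 divff// subrr powRr0 divr1.
rewrite /far/=.
suff : forall j, (j <= k)%N -> a ^+ j * r - j%:R * N <= enorm (x j).
  by apply.
elim=> [_|j IH jk].
  rewrite expr0 mul1r mul0r subr0.
  by have /andP[] := enorm_box d0 r0 x0.
have nxi : enorm (xi j) <= d%:R * (2 * lam).
  apply: enorm_le; first by rewrite mulr_ge0.
  move=> i; have n1 := noise j.+1 i jk; have n2 := noise j i (ltnW jk).
  have -> : xi j 0 i = (\sum_(l < j.+1) xi l) 0 i - (\sum_(l < j) xi l) 0 i.
    by rewrite big_ord_recr/= mxE addrAC subrr add0r.
  by rewrite (le_trans (ler_normB _ _))//; lra.
have s1 : a * enorm (x j) - N <= enorm (x j.+1).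
  have : enorm (x j) - enorm (h *: grad V (x j)) - enorm (Num.sqrt (2 * h) *: xi j)
      <= enorm (x j.+1).
    rewrite xS.
    have e1 := enormB (x j) (h *: grad V (x j)).
    have := enormB (x j - h *: grad V (x j)) (- (Num.sqrt (2 * h) *: xi j)).
    rewrite opprK enormN.
    by lra.
  apply: le_trans; rewrite !enormZ (gtr0_norm h0) ger0_norm ?sqrtr_ge0//.
  have h1 : h * enorm (grad V (x j)) <= h * (b * enorm (x j)).
    by apply: ler_wpM2l; [exact: ltW|exact: lin].
  have h2 : Num.sqrt (2 * h) * enorm (xi j) <= N.
    by apply: ler_wpM2l => //; exact: sqrtr_ge0.
  by rewrite /a; lra.
apply: le_trans s1.
have := IH (ltnW jk) => /(ler_wpM2l (ltW a0)).
rewrite exprS -natr1 mulrBr mulrA.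
have : a * (j%:R * N) <= j%:R * N by rewrite ler_piMl// mulr_ge0.
by lra.
Qed.

End lmc_path.

Section barrier.
Context {R : realType}.

Lemma within_continuous_dist (f : R -> R) (t s : R) :
  {within `[0, t], continuous f} -> 0 <= s <= t -> forall e, 0 < e ->
  exists2 del, 0 < del & forall u, 0 <= u <= t -> `|s - u| < del -> `|f s - f u| < e.
Proof.
move=> /subspace_continuousP cf st e e0; have := cf s.
rewrite /= in_itv/= => /(_ st)/cvgrPdist_lt/(_ e e0).
rewrite near_withinE => /nbhs_ballP[del /= del0 near_s].
exists del => // u ut su; apply: (near_s u su).
by rewrite /= in_itv.
Qed.

(** Induction in continuous time. Up to the supremum [m] of the times before which [g <= c], the
    bound improves to [c']; the gap between [c'] and [c] lets continuity carry it past [m]. *)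
Lemma barrier (g : R -> R) (t c c' : R) : {within `[0, t], continuous g} ->
  c' < c -> g 0 <= c ->
  (forall s, 0 <= s <= t -> (forall u, 0 <= u <= s -> g u <= c) -> g s <= c') ->
  forall s, 0 <= s <= t -> g s <= c.
Proof.
move=> cg cc' g0 hg s1 /andP[s10 s1t].
rewrite leNgt; apply/negP => cs1.
pose Z := [set s | 0 <= s <= s1 /\ forall u, 0 <= u <= s -> g u <= c].
have Z0 : Z 0.
  split; first by rewrite lexx.
  by move=> u u0; have -> : u = 0 by apply/eqP; rewrite eq_le andbC.
have ubZ : ubound Z s1 by move=> s [/andP[]].
have supZ : has_sup Z by split; [exists 0|exists s1].
pose m := sup Z.
have m0 : 0 <= m by apply: sup_upper_bound.
have ms1 : m <= s1 by apply: ge_sup => //; exists 0.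
have mt : 0 <= m <= t by rewrite m0 (le_trans ms1).
(* Half of the gap, since continuity at [m] is used twice: from the earlier time [z] to [m], then
   from [m] to the later time [u]. *)
pose e := (c - c') / 2; have e0 : 0 < e by rewrite divr_gt0// subr_gt0.
have [del del0 near_m] := within_continuous_dist cg mt e0.
have [z Zz zm] : exists2 z, Z z & m - del < z.
  by have [z Zz ?] := sup_adherent del0 supZ; exists z.
have [/andP[z0 zs1] gz] := Zz.
have zlem : z <= m by apply: sup_upper_bound.
have gzc' : g z <= c' by apply: hg => //; rewrite z0 (le_trans zs1).
have gm : `|g m - g z| < e.
  apply: near_m; first by rewrite z0 (le_trans zs1).
  by rewrite ger0_norm ?subr_ge0//; lra.
pose v := Num.min (m + del / 2) s1.
have v0 : 0 <= v by rewrite le_min s10 andbT; lra.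
have vs1 : v <= s1 by rewrite ge_min lexx orbT.
have vm : v <= m + del / 2 by rewrite ge_min lexx.
have Zv : Z v.
  split; first by rewrite v0.
  move=> u /andP[u0 uv]; have [uz|zu] := leP u z; first by apply: gz; rewrite u0.
  have : `|g m - g u| < e.
    apply: near_m; first by rewrite u0 (le_trans uv)// (le_trans vs1).
    by rewrite ltr_norml; lra.
  move: gm; rewrite !ltr_norml => /andP[gm1 gm2] /andP[gu1 gu2].
  by move: e0; rewrite /e in gm1 gm2 gu1 gu2 *; lra.
have : v <= m by apply: sup_upper_bound.
rewrite ge_min => /orP[|s1m]; first by lra.
have vE : v = s1 by apply/min_idPr; lra.
by case: Zv => _ /(_ s1); rewrite vE s10 lexx leNgt cs1 => /(_ isT).
Qed.

End barrier.

Section langevin_path.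
Context {R : realType} {d : nat}.
Variables (b alpha : R) (V : 'rV[R]_d -> R).
Hypothesis d0 : (0 < d)%N.
Hypothesis b0 : 0 < b.
Hypothesis alpha2 : 0 <= alpha <= 2.
Hypothesis gradV : forall x, enorm (grad V x) <=
  b * enorm x / (1 + enorm x ^+ 2) `^ (1 - alpha / 2).
Variables (B X : R -> 'rV[R]_d) (t : R).
Hypothesis t0 : 0 <= t.
Hypothesis cX : {within `[0, +oo[, continuous X}.
Hypothesis eqX : forall s : R, 0 <= s -> forall i : 'I_d,
  lebesgue_measure.-integrable `[0, s] (fun u : R => (grad V (X u) 0 i)%:E) /\
  X s 0 i = X 0 0 i - \int[lebesgue_measure]_(u in `[0, s]) grad V (X u) 0 i
            + Num.sqrt 2 * B s 0 i.

Let cXt : {within `[0, t], continuous X}.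
Proof.
by apply: continuous_subspaceW cX => s /=; rewrite !in_itv/= => /andP[->].
Qed.

Let incr u v i (G : R) : 0 <= u -> u <= v ->
  (forall s, u <= s <= v -> `|grad V (X s) 0 i| <= G) ->
  `|X v 0 i - X u 0 i| <= (v - u) * G + Num.sqrt 2 * `|B v 0 i - B u 0 i|.
Proof.
move=> u0 uv hG; have v0 := le_trans u0 uv.
have [iv Xv] := eqX v0 i; have [_ Xu] := eqX u0 i.
have E : X v 0 i - X u 0 i =
    - (\int[lebesgue_measure]_(s in `]u, v]) grad V (X s) 0 i)
    + Num.sqrt 2 * (B v 0 i - B u 0 i).
  rewrite -(@Rintegral_itvB _ (fun s => grad V (X s) 0 i) (BLeft 0) (BRight v) u iv).
  - by rewrite Xv Xu; ring.
  - by rewrite bnd_simp.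
  - by rewrite bnd_simp.
have iuv : lebesgue_measure.-integrable `]u, v]
    (EFin \o (fun s : R => grad V (X s) 0 i)).
  apply: (integrableS _ _ _ iv) => //.
  move=> s /=; rewrite !in_itv/= => /andP[us ->]; rewrite andbT.
  by rewrite (le_trans u0)// ltW.
rewrite E (le_trans (ler_normD _ _))// normrN normrM (ger0_norm (sqrtr_ge0 _)).
rewrite lerD2r (le_trans (le_normr_Rintegral _ iuv))//.
have mfin : (lebesgue_measure `]u, v]%classic < +oo :> \bar R)%E.
  by rewrite lebesgue_measure_itv/=; case: ifP => _; rewrite ltry.
apply: (@le_trans _ _ (\int[lebesgue_measure]_(s in `]u, v]) G)).
  apply: le_Rintegral => //.
  - exact: integrable_norm.
  - apply: measurable_bounded_integrable => //.
    exists `|G|; split; first exact: num_real.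
    by move=> y Gy s _; exact: ltW.
  - move=> s /=; rewrite in_itv/= => /andP[us sv]; apply: hG.
    by rewrite sv (ltW us).
rewrite Rintegral_cst//.
rewrite [X in fine X](_ : _ = @lebesgue_measure R `]u, v]%classic)//.
rewrite lebesgue_measure_itv/= lte_fin.
case: ltP => [_|vu] /=; first by rewrite mulrC.
by have -> : v = u by [lra]; rewrite subrr mulr0 mul0r.
Qed.

Variable lam : R.
Hypothesis noise : forall s i, 0 <= s <= t -> `|(B s - B 0) 0 i| <= lam.

Let sqrt2_le2 : Num.sqrt 2 <= 2 :> R.
Proof.
by rewrite -[leRHS]ger0_norm// -sqrtr_sqr ler_sqrt; lra.
Qed.

Lemma langevin_path_shell (r : R) : 0 < r -> box r (X 0) -> 2 * lam <= r / 4 ->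
  t * (12 * b * d%:R * r `^ (alpha - 1)) <= r / 8 -> far (r / 2) (X t).
Proof.
move=> r0 x0 lamr drift.
set G := 12 * b * d%:R * r `^ (alpha - 1) in drift.
have G0 : 0 <= G by rewrite !mulr_ge0 ?powR_ge0// ltW.
pose g s := `|X s - X 0|.
have coord s c : 0 <= c -> (g s <= c) <-> (forall i, `|X s 0 i - X 0 0 i| <= c).
  move=> c0; split => [gs i|xs].
    by have := rV_coord_le_norm (X s - X 0) i; rewrite !mxE => /le_trans; apply.
  rewrite /g [`|_ - _|]mx_normrE; apply: bigmax_le => //= -[i j] _ /=.
  by rewrite (ord1 i) !mxE.
have shell s : g s <= r / 2 -> r / 2 <= enorm (X s) <= 3 * d%:R * r.
  move=> /(coord s _ (ltW (divr_gt0 r0 (ltr0n _ 2)))).1 xj; apply/andP; split.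
    have i := Ordinal d0.
    have /andP[rx _] := x0 i; have := xj i; rewrite ler_distl => /andP[xl _].
    apply: (le_trans _ (coord_le_enorm _ i)); apply: (le_trans _ (ler_norm _)).
    by lra.
  rewrite -mulrA mulrCA; apply: enorm_le; first by rewrite mulr_ge0// ltW.
  move=> i; have /andP[rx xr] := x0 i; have := xj i; rewrite ler_distl => /andP[xl xu].
  by rewrite ler_norml; lra.
suff : g t <= r / 2 by move=> /shell/andP[].
(* [3 * r / 8] is the drift [r / 8] plus the noise [r / 4]. The strict gap to [r / 2] is the reason
   for a smaller drift allowance than for the chain. *)
apply: (@barrier _ g t (r / 2) (3 * r / 8)).
- apply/subspace_continuousP => s st; apply: cvg_norm.
  by apply: cvgB; [move/subspace_continuousP : cXt; exact|exact: cvg_cst].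
- by lra.
- by rewrite /g subrr normr0; lra.
- move=> s /andP[s0 st] hs; apply/coord; first by lra.
  move=> i; apply: (le_trans (incr (G := G) (lexx 0) s0 _)).
    by move=> u us; apply: (grad_shell b0 alpha2 gradV) => //; apply: shell; exact: hs.
  rewrite subr0.
  have h1 : s * G <= r / 8 by rewrite (le_trans _ drift)// ler_wpM2r.
  have h2 : Num.sqrt 2 * `|B s 0 i - B 0 0 i| <= 2 * lam.
    apply: ler_pM => //.
    by have := @noise s i; rewrite s0 st !mxE => /(_ isT).
  by lra.
- by rewrite t0 lexx.
Qed.

(** A discrete backward Gronwall argument: on each of [n] intervals of length at most
    [1 / (2 * beta)] the norm at most halves, up to noise, and the factors compose to [2 ^ n]. *)
Lemma langevin_path_linear (n : nat) (r : R) : alpha = 2 -> 0 <= r -> 0 <= lam ->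
  2 * (b * d%:R) * t <= n%:R -> (0 < n)%N -> box r (X 0) ->
  far ((2 ^ n)%:R^-1 * r - 8 * lam) (X t).
Proof.
move=> a2 r0 lam0 tn n0 x0.
set beta := b * d%:R in tn.
have beta0 : 0 <= beta by rewrite mulr_ge0// ltW.
pose N s := `|X s|.
have N0 s : 0 <= N s by exact: normr_ge0.
have lin y i : `|grad V y 0 i| <= beta * `|y|.
  apply: (le_trans (coord_le_enorm _ _)).
  have := gradV y; rewrite a2 divff// subrr powRr0 divr1 => /le_trans; apply.
  rewrite /beta -mulrA; apply: ler_wpM2l; first exact: ltW.
  by apply: enorm_le => // j; exact: rV_coord_le_norm.
have cN : {within `[0, t], continuous N}.
  apply/subspace_continuousP => s st; apply: cvg_norm.
  by move/subspace_continuousP : cXt; exact.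
have step u v : 0 <= u -> u <= v -> v <= t -> beta * (v - u) <= 2^-1 ->
    N u <= 2 * N v + 8 * lam.
  move=> u0 uv vt buv.
  have cNuv : {within `[u, v], continuous N}.
    apply: continuous_subspaceW cN => s /=; rewrite !in_itv/= => /andP[us sv].
    by rewrite (le_trans u0 us) (le_trans sv vt).
  (* At the maximum [c] the drift is at most [beta * (v - u) * N c <= N c / 2], which can be
     absorbed on the left. *)
  have [c cuv Nc] := EVT_max uv cNuv.
  move: cuv; rewrite in_itv/= => /andP[uc cv].
  have c0 := le_trans u0 uc.
  have Ncv : N c <= N v + (beta * (v - u) * N c + 4 * lam).
    have Nvc : N c <= N v + `|X v - X c|.
      rewrite /N -[X in _ <= _ + X]normrN opprB (le_trans _ (ler_normD _ _))//.
      by rewrite addrC subrK.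
    apply: (le_trans Nvc); rewrite lerD2l [`|_ - _|]mx_normrE; apply: bigmax_le.
      by apply: addr_ge0; [apply: mulr_ge0 => //; apply: mulr_ge0 => //; lra|lra].
    move=> -[i j] _ /=; rewrite (ord1 i) !mxE.
    apply: (le_trans (incr (G := beta * N c) c0 cv _)).
      move=> s /andP[cs sv]; apply: (le_trans (lin _ _)); apply: ler_wpM2l => //.
      by apply: Nc; rewrite in_itv/= sv (le_trans uc).
    apply: lerD.
      rewrite mulrA [X in X * _]mulrC; apply: ler_wpM2r => //.
      by apply: ler_wpM2l => //; lra.
    have nv : `|B v 0 j - B 0 0 j| <= lam.
      by have := @noise v j; rewrite (le_trans u0 uv) vt !mxE => /(_ isT).
    have nc : `|B c 0 j - B 0 0 j| <= lam.
      by have := @noise c j; rewrite c0 (le_trans cv vt) !mxE => /(_ isT).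
    have nvc : `|B v 0 j - B c 0 j| <= 2 * lam.
      have -> : B v 0 j - B c 0 j = (B v 0 j - B 0 0 j) - (B c 0 j - B 0 0 j) by ring.
      by rewrite (le_trans (ler_normB _ _))//; lra.
    have : Num.sqrt 2 * `|B v 0 j - B c 0 j| <= 2 * (2 * lam).
      by apply: ler_pM.
    by lra.
  have NuN : N u <= N c by apply: Nc; rewrite in_itv/= lexx.
  have : beta * (v - u) * N c <= 2^-1 * N c by apply: ler_wpM2r.
  by lra.
have nR : 0 < n%:R :> R by rewrite ltr0n.
have tj j : (j <= n)%N -> N 0 <= (2 ^ j)%:R * N (t * j%:R / n%:R) +
    ((2 ^ j)%:R - 1) * (8 * lam).
  elim: j => [_|j IH jn].
    by rewrite expn0 mulr0 mul0r subrr mul0r addr0 mul1r.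
  apply: (le_trans (IH (ltnW jn))).
  have st : N (t * j%:R / n%:R) <= 2 * N (t * j.+1%:R / n%:R) + 8 * lam.
    apply: step.
    - by rewrite divr_ge0// mulr_ge0.
    - by rewrite ler_pM2r ?invr_gt0// ler_wpM2l// ler_nat.
    - by rewrite ler_pdivrMr// ler_wpM2l// ler_nat.
    - rewrite -mulrBl -mulrBr -natr1 addrAC subrr add0r mulr1 mulrA.
      by rewrite ler_pdivrMr//; lra.
  have p2 : 0 <= (2 ^ j)%:R :> R by [].
  have := ler_wpM2l p2 st; rewrite expnS natrM.
  set p := (2 ^ j)%:R; set N1 := N _; set N2 := N _ => h.
  have -> : 2 * p * N2 + (2 * p - 1) * (8 * lam) =
    p * (2 * N2 + 8 * lam) + (p - 1) * (8 * lam) by ring.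
  by rewrite lerD2r.
have := tj n (leqnn n); rewrite mulfK ?gt_eqF//.
have p0 : 0 < (2 ^ n)%:R :> R by rewrite ltr0n expn_gt0.
set p := (2 ^ n)%:R in p0 *.
rewrite /far/= => hN.
have rN : r <= N 0.
  have i := Ordinal d0; have /andP[rx _] := x0 i.
  by rewrite (le_trans rx)// (le_trans (ler_norm _))// rV_coord_le_norm.
have NE : N t <= enorm (X t).
  rewrite /N [`|_|]mx_normrE; apply: bigmax_le; first exact: enorm_ge0.
  by move=> -[i j] _ /=; rewrite (ord1 i) coord_le_enorm.
apply: le_trans NE; rewrite lerBlDr -ler_pdivlMl ?invr_gt0// invrK.
by lra.
Qed.

End langevin_path.

Lemma ae_le_measure {R : realType} {disp : measure_display}
    {T : measurableType disp} (P : {measure set T -> \bar R}) (A B : set T) :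
  measurable A -> measurable B -> {ae P, forall w, A w -> B w} ->
  (P A <= P B)%E.
Proof.
move=> mA mB [N [mN PN sN]].
apply: (@le_trans _ _ (P (B `|` N))).
  apply: le_measure; rewrite ?inE//; first exact: measurableU.
  move=> w Aw; have [Nw|nNw] := pselect (N w); [by right|left].
  by apply: contrapT => nB; apply: nNw; apply: sN => /= /(_ Aw).
apply: (le_trans (measureU2 _ mB mN)).
by rewrite [X in (_ + X)%E](_ : _ = 0%E)// adde0.
Qed.

(** * From paths to laws *)

Section laws.
Context {R : realType} {d : nat}.
Variables (b alpha : R) (V : 'rV[R]_d -> R).
Hypothesis d0 : (0 < d)%N.
Hypothesis b0 : 0 < b.
Hypothesis alpha2 : 0 <= alpha <= 2.
Hypothesis gradV : forall x, enorm (grad V x) <=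
  b * enorm x / (1 + enorm x ^+ 2) `^ (1 - alpha / 2).
Implicit Types mu : probability 'rV[R]_d R.

(** Reduces a bound on laws to a deterministic claim about one path with bounded noise; [A] is the
    shell event for [alpha < 2] and the linear one for [alpha = 2]. *)
Let lmc_law_event h mu0 k muk (r lam : R) (A : set 'rV[R]_d) :
  lmc_law V h mu0 k muk -> 0 < lam -> (16 * d * k)%:R <= lam ^+ 2 ->
  measurable A ->
  (forall x xi : nat -> 'rV[R]_d,
    (forall j, x j.+1 = x j - h *: grad V (x j) + Num.sqrt (2 * h) *: xi j) ->
    box r (x 0%N) ->
    (forall j i, (j <= k)%N -> `|(\sum_(l < j) xi l) 0 i| <= lam) -> A (x k)) ->
  ((2^-1)%:E * mu0 (box r) <= muk A)%E.
Proof.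
move=> [disp [T [P [x [xi [chain [_ x0] [mxk xk]]]]]]] lam0 klam mA path.
have := lmc_noise_bound chain (measurable_box r) lam0 klam.
rewrite x0; last exact: measurable_box.
move=> /le_trans; apply; rewrite -xk//.
case: chain => mx0 gxi _ xS.
apply: le_measure; rewrite ?inE.
- apply: measurableI.
    rewrite -[X in measurable X]setTI; apply: mx0 => //; exact: measurable_box.
  apply: (measurable_walk_event (W := fun j w => \sum_(l < j) xi l w)) => j.
  apply/measurable_fun_rVP => i.
  rewrite (_ : (fun _ => _) = fun t => \sum_(l < j) xi l t 0 i); last first.
    by apply/funext => t; rewrite summxE.
  apply: measurable_sum => l.
  apply: (measurableT_comp (measurable_rV_coord i)).
  by case: (gxi l).
- by rewrite -[X in measurable X]setTI; exact: mxk.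
- by move=> w [/= boxw noise]; apply: (path (x ^~ w) (xi ^~ w)).
Qed.

Lemma lmc_law_shell (h r : R) (k : nat) mu0 muk : 0 < h -> 0 < r ->
  k%:R * h * (12 * b * d%:R * r `^ (alpha - 1)) <= r / 8 ->
  1024 * d%:R * (k%:R * h) <= r ^+ 2 ->
  lmc_law V h mu0 k muk -> ((2^-1)%:E * mu0 (box r) <= muk (far (r / 2)))%E.
Proof.
move=> h0 r0 drift noise law.
have h2 : 0 < 2 * h by rewrite mulr_gt0.
have sq0 : 0 < Num.sqrt (2 * h) by rewrite sqrtr_gt0.
(* Makes the noise displacement exactly [r / 4]; the walk bound then asks for
   [512 * d * k * h <= r ^+ 2]. *)
pose lam := r / 4 / Num.sqrt (2 * h).
have lam0 : 0 < lam by rewrite !divr_gt0.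
apply: (lmc_law_event (lam := lam) law) => //.
- rewrite /lam expr_div_n sqr_sqrtr ?(ltW h2)// ler_pdivlMr// !natrM.
  have -> : (r / 4) ^+ 2 = r ^+ 2 / 16 by field.
  have : 0 <= d%:R * (k%:R * h) by rewrite !mulr_ge0// ltW.
  by lra.
- exact: measurable_far.
move=> x xi xS x0 xin.
apply: (lmc_path_shell d0 b0 h0 alpha2 gradV xS r0 x0 xin).
  by rewrite mulrC divfK ?gt_eqF.
by rewrite (le_trans drift)// ler_wpM2l ?(ltW r0)//; lra.
Qed.

(** [delta] and [K] may depend on [h] and [k], but are chosen before [r], which is then taken as
    large as they require. *)
Lemma lmc_law_linear (h : R) (k : nat) : alpha = 2 -> 0 < h -> h * b < 1 ->
  exists delta K : R, 0 < delta /\ forall (r : R) mu0 muk, 0 <= r ->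
    lmc_law V h mu0 k muk ->
    ((2^-1)%:E * mu0 (box r) <= muk (far (delta * r - K)))%E.
Proof.
move=> a2 h0 hb.
pose lam : R := (16 * d * k)%:R + 1.
have lam1 : 1 <= lam by rewrite lerDr.
exists ((1 - h * b) ^+ k), (k%:R * (Num.sqrt (2 * h) * (d%:R * (2 * lam)))).
split; first by rewrite exprn_gt0// subr_gt0.
move=> r mu0 muk r0 law.
have lam0 : 0 < lam by rewrite (lt_le_trans _ lam1).
apply: (lmc_law_event (lam := lam) law) => //.
- rewrite expr2 (@le_trans _ _ lam)//; first by rewrite lerDl.
  by rewrite ler_peMr// ltW.
- exact: measurable_far.
move=> x xi xS x0 xin.
exact: (lmc_path_linear d0 b0 h0 gradV a2 hb xS r0 (ltW lam0) x0 xin).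
Qed.

Let langevin_law_event (t r lam : R) rho0 rhot (A : set 'rV[R]_d) :
  langevin_law V rho0 t rhot -> 0 < t -> 0 < lam -> 16 * d%:R * t <= lam ^+ 2 ->
  measurable A ->
  (forall B X : R -> 'rV[R]_d, {within `[0, +oo[, continuous X} ->
    (forall s : R, 0 <= s -> forall i : 'I_d,
      lebesgue_measure.-integrable `[0, s] (fun u : R => (grad V (X u) 0 i)%:E) /\
      X s 0 i = X 0 0 i - \int[lebesgue_measure]_(u in `[0, s]) grad V (X u) 0 i
                + Num.sqrt 2 * B s 0 i) ->
    (forall s i, 0 <= s <= t -> `|(B s - B 0) 0 i| <= lam) ->
    box r (X 0) -> A (X t)) ->
  ((2^-1)%:E * rho0 (box r) <= rhot A)%E.
Proof.
move=> [disp [T [P [F [B [X [sol [_ x0] [mxt xt]]]]]]]] t0 lam0 tlam mA path.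
case: sol => filF BM adX cX eqX.
have mbox : measurable (@box R d r) by exact: measurable_box.
have FC : F 0 (X 0 @^-1` box r) by exact: adX.
have := bm_event_bound filF BM FC t0 lam0 tlam.
rewrite x0// => /le_trans; apply; rewrite -xt//.
apply: ae_le_measure.
- exact: (measurable_bm_event filF BM lam FC t0).
- by rewrite -[X in measurable X]setTI; exact: mxt.
case: BM => _ _ cB _ _.
apply: filterS (filterI cB (filterI cX eqX)) => w [cBw [cXw eqXw]] Ew /=.
apply: (path (B ^~ w) (X ^~ w)) => //.
  by move=> s i st; exact: (bm_event_path t0 i Ew cBw st).
by have [] := Ew 0%N I.
Qed.

(** Time 0 is separate because the dyadic noise bound is set up for a positive time. *)
Let langevin_law0 (r : R) rho0 rhot : langevin_law V rho0 0 rhot -> 0 <= r ->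
  ((2^-1)%:E * rho0 (box r) <= rhot (far r))%E.
Proof.
move=> [disp [T [P [F [B [X [_ [_ x0] [mxt xt]]]]]]]] r0.
have mbox : measurable (@box R d r) by exact: measurable_box.
have mfar : measurable (@far R d r) by exact: measurable_far.
rewrite -xt// -x0//.
apply: (@le_trans _ _ (P (X 0 @^-1` box r))).
  rewrite -[leRHS]mul1e lee_wpmul2r// lee_fin.
  by rewrite invf_le1 ?ler1n.
apply: le_measure; rewrite ?inE.
- by rewrite -[X in measurable X]setTI; exact: mxt.
- by rewrite -[X in measurable X]setTI; exact: mxt.
- by move=> w /= /(enorm_box d0 r0)/andP[].
Qed.

Let far_le (mu : probability 'rV[R]_d R) (r s : R) : s <= r ->
  (mu (far r) <= mu (far s))%E.
Proof.
move=> sr; apply: le_measure; rewrite ?inE; try exact: measurable_far.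
by move=> x; rewrite /far/=; exact: le_trans.
Qed.

Lemma langevin_law_shell (t r : R) rho0 rhot : 0 <= t -> 0 < r ->
  t * (12 * b * d%:R * r `^ (alpha - 1)) <= r / 8 ->
  1024 * d%:R * t <= r ^+ 2 ->
  langevin_law V rho0 t rhot -> ((2^-1)%:E * rho0 (box r) <= rhot (far (r / 2)))%E.
Proof.
rewrite le_eqVlt => /predU1P[<-|t0] r0 drift noise law.
  apply: (le_trans (langevin_law0 law (ltW r0))); apply: far_le.
  by lra.
have lam0 : 0 < r / 8 by rewrite divr_gt0.
(* Here [2 * lam = r / 4], and [16 * d * t <= (r / 8) ^+ 2] is the origin of the constant 1024. *)
apply: (langevin_law_event (lam := r / 8) law) => //.
- have -> : (r / 8) ^+ 2 = r ^+ 2 / 64 by field.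
  by lra.
- exact: measurable_far.
move=> B X cX eqX nB x0.
apply: (langevin_path_shell d0 b0 alpha2 gradV (ltW t0) cX eqX nB) => //.
by lra.
Qed.

Lemma langevin_law_linear (t : R) : alpha = 2 -> 0 <= t ->
  exists delta K : R, 0 < delta /\ forall (r : R) rho0 rhot, 0 <= r ->
    langevin_law V rho0 t rhot ->
    ((2^-1)%:E * rho0 (box r) <= rhot (far (delta * r - K)))%E.
Proof.
move=> a2 t0.
pose lam : R := 16 * d%:R * t + 1.
have lam1 : 1 <= lam by rewrite lerDr !mulr_ge0.
have lam0 : 0 < lam by rewrite (lt_le_trans _ lam1).
pose n := (Num.truncn (2 * (b * d%:R) * t)).+1.
exists (2 ^ n)%:R^-1, (8 * lam).
have p0 : 0 < (2 ^ n)%:R :> R by rewrite ltr0n expn_gt0.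
split; first by rewrite invr_gt0.
move=> r rho0 rhot r0; move: t0 (t0); rewrite {1}le_eqVlt => /predU1P[<- _|t0 t0'] law.
  apply: (le_trans (langevin_law0 law r0)); apply: far_le.
  rewrite lerBlDr (@le_trans _ _ r)//; last by rewrite lerDl mulr_ge0// ltW.
  by rewrite ler_piMl// invf_le1// ler1n expn_gt0.
apply: (langevin_law_event (lam := lam) law) => //.
- rewrite expr2 (@le_trans _ _ lam)//; first by rewrite lerDl.
  by rewrite ler_peMr// ltW.
- exact: measurable_far.
move=> B X cX eqX nB x0.
apply: (langevin_path_linear d0 b0 gradV t0' cX eqX nB) => //.
- exact: ltW.
- by rewrite ltW// truncnS_gt.
Qed.

End laws.

(** * Complexity lower bounds *)

Section complexity_bounds.
Context {R : realType} {d : nat}.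
Variables (b alpha : R) (V : 'rV[R]_d -> R) (pi : probability 'rV[R]_d R) (q : R).
Hypothesis d0 : (0 < d)%N.
Hypothesis b0 : 0 < b.
Hypothesis alpha2 : 0 <= alpha <= 2.
Hypothesis dV : forall x, differentiable V x.
Hypothesis gibbsV : gibbs V pi.
Hypothesis q1 : 1 < q.
Hypothesis moment : (\int[pi]_x (enorm x `^ (2 * q / (q - 1)))%:E < +oo)%E.
Hypothesis gradV : forall x, enorm (grad V x) <=
  b * enorm x / (1 + enorm x ^+ 2) `^ (1 - alpha / 2).

(** The summand [96 = 12 * 8] keeps the drift below [r / 8], the summand 1024 meets the noise
    condition. *)
Let kappa : R := (96 * b * d%:R + 1024 * d%:R)^-1.

Let dR : 0 < d%:R :> R. Proof. by rewrite ltr0n. Qed.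

Let kappaV : 0 < 96 * b * d%:R + 1024 * d%:R.
Proof.
have bd : 0 < b * d%:R by rewrite mulr_gt0.
by move: dR bd; lra.
Qed.

Let kappa0 : 0 < kappa. Proof. by rewrite invr_gt0. Qed.

(* In time [kappa r^(2 - alpha)] neither the drift nor the noise can bring
   the process from the box of size [r] to within distance [r / 2] of [0]. *)
Lemma complexity_ge : exists2 rho : R, 1 <= rho &
  forall (r Delta0 tau : R), rho <= r ->
  ((expR (- Delta0))%:E <= pi (box r))%E ->
  tau <= kappa * r `^ (2 - alpha) ->
  forall q' : \bar R, (1 <= q')%E ->
    (forall h : R, 0 < h ->
      ((tau / h)%:E <=
       lmc_complexity (renyi q%:E) (renyi q') V pi h Delta0 1)%E) /\
    (tau%:E <= langevin_complexity (renyi q%:E) (renyi q') V pi Delta0 1)%E.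
Proof.
have [r0 r00 tail] := renyi_tail q1 moment (ltr01 : 0 < 1 :> R).
(* Ensures [r0 <= r / 2], where the tail bound starts, and [2 <= r / 2], so that the tail is at most
   [1 / 4], below the surviving mass [1 / 2]. *)
exists (2 * r0 + 4); first by lra.
move=> r Delta0 tau rhor boxr taur q' q'1.
have r1 : 1 <= r by lra.
have rgt0 : 0 < r by lra.
have [mu0 mu0box mu0renyi] := conditioned_law (measurable_box r) boxr.
have drift s : s <= tau -> s * (12 * b * d%:R * r `^ (alpha - 1)) <= r / 8.
  move=> stau; have G0 : 0 <= 12 * b * d%:R * r `^ (alpha - 1).
    by rewrite !mulr_ge0 ?powR_ge0// ltW.
  apply: (le_trans (ler_wpM2r G0 (le_trans stau taur))).
  have E : r `^ (2 - alpha) * r `^ (alpha - 1) = r.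
    rewrite -powRD; last by rewrite (gt_eqF rgt0)/= implybT.
    by rewrite (_ : _ + _ = 1); [rewrite powRr1// ltW|ring].
  have -> : kappa * r `^ (2 - alpha) * (12 * b * d%:R * r `^ (alpha - 1)) =
      12 * b * d%:R * (r `^ (2 - alpha) * r `^ (alpha - 1)) / (kappa^-1).
    by rewrite invrK; ring.
  rewrite E /kappa invrK (ler_pdivrMr _ _ kappaV).
  have : 0 <= r * d%:R by rewrite mulr_ge0// ltW.
  by lra.
have noise s : s <= tau -> 1024 * d%:R * s <= r ^+ 2.
  move=> stau; have D0 : 0 <= 1024 * d%:R :> R by move: dR; lra.
  apply: (le_trans (ler_wpM2l D0 (le_trans stau taur))).
  have -> : r ^+ 2 = r `^ 2 by rewrite powR_mulrn// ltW.
  have rr : r `^ (2 - alpha) <= r `^ 2.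
    by apply: ler_powR => //; have /andP[] := alpha2; lra.
  apply: le_trans rr; rewrite mulrA; apply: (ler_piMl (powR_ge0 _ _)).
  rewrite /kappa (ler_pdivrMr _ _ kappaV) mul1r.
  have : 0 <= b * d%:R by rewrite mulr_ge0// ltW.
  by lra.
have absurd mu : (renyi q%:E mu pi <= 1%:E)%E ->
    ((2^-1)%:E * mu0 (box r) <= mu (far (r / 2)))%E -> False.
  move=> renyi1; have := tail (r / 2) _ mu renyi1.
  have r0r : r0 <= r / 2 by lra.
  move=> /(_ r0r) tl; rewrite mu0box mule1 => /le_trans/(_ tl).
  rewrite lee_fin ler_pdivlMr ?exprn_gt0 ?divr_gt0// leNgt => /negP; apply.
  have : 2 ^+ 2 <= (r / 2) ^+ 2 by rewrite lerXn2r ?nnegrE; lra.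
  by lra.
split.
  move=> h h0; apply: le_ereal_inf_tmp => _ [k hk <-]; rewrite lee_fin leNgt.
  apply/negP; rewrite ltr_pdivlMr// => /ltW kh.
  have [muk law renyi1] := hk mu0 (mu0renyi q' q'1).
  apply: (absurd muk renyi1).
  apply: (lmc_law_shell d0 b0 alpha2 gradV h0 rgt0 _ _ law).
    exact: drift.
  exact: noise.
apply: le_ereal_inf_tmp => _ [t [t0 ht] <-]; rewrite lee_fin leNgt.
apply/negP => /ltW ttau.
have [rhot law renyi1] := ht mu0 (mu0renyi q' q'1).
apply: (absurd rhot renyi1).
apply: (langevin_law_shell d0 b0 alpha2 gradV t0 rgt0 _ _ law).
  exact: drift.
exact: noise.
Qed.

(* A mass [w ~ r^-2] placed at distance [r] costs a bounded KL divergence,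
   whereas [renyi q mu pi <= 1] only leaves mass [o(r^-2)] at distance [r]. *)
Lemma KL_ball_unreachable (delta K : R) : alpha = 2 -> 0 < delta ->
  exists (r : R) (mu0 : probability 'rV[R]_d R), [/\ 0 <= r,
    (KL mu0 pi <= 2%:E)%E &
    forall mu : probability 'rV[R]_d R,
      ((2^-1)%:E * mu0 (box r) <= mu (far (delta * r - K)))%E ->
      ~ (renyi q%:E mu pi <= 1%:E)%E].
Proof.
move=> a2 delta0.
have a0 : 0 < alpha by rewrite a2.
have [K' [C [K'0 mass]]] := box_mass_powR d0 b0 dV gibbsV gradV a0.
pose L := K' + `|C| + 1.
have C0 : 0 <= `|C| by [].
have L0 : 0 < L by rewrite /L; lra.
(* With this tail constant the mass allowed beyond [delta * r / 2] is [w / 4], whereas at least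
   [w / 2] survives. *)
have eps0 : 0 < delta ^+ 2 / (16 * L) by rewrite divr_gt0 ?exprn_gt0// mulr_gt0.
have [r0 r00 tail] := renyi_tail q1 moment eps0.
(* Large enough that [delta * r - K] is at least [delta * r / 2], itself at least [r0]. *)
pose r := 1 + 2 * (`|K| + r0) / delta.
have r1 : 1 <= r by rewrite lerDl divr_ge0 ?mulr_ge0 ?addr_ge0// ltW.
have rgt0 : 0 < r by rewrite (lt_le_trans _ r1).
have dr : 2 * (`|K| + r0) <= delta * r.
  have -> : delta * r = delta + 2 * (`|K| + r0) by rewrite /r; field; rewrite gt_eqF.
  by rewrite lerDr ltW.
have Dle : K' * r `^ alpha + C <= L * r ^+ 2.
  have -> : r `^ alpha = r ^+ 2 by rewrite a2 powR_mulrn// ltW.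
  rewrite /L mulrDl mulrDl mul1r -addrA lerD2l.
  have r2 : 1 <= r ^+ 2 by rewrite exprn_ege1.
  have : C <= `|C| * r ^+ 2.
    by rewrite (le_trans (ler_norm _))// ler_peMr.
  by lra.
(* [L * r ^+ 2] dominates the cost of conditioning on the box, so [mixed_law] gives a divergence of
   at most [1 + 1]. *)
pose w := (L * r ^+ 2)^-1.
have Lr0 : 0 < L * r ^+ 2 by rewrite mulr_gt0// exprn_gt0.
have w01 : 0 <= w <= 1.
  rewrite invr_ge0 (ltW Lr0)/= invf_le1//.
  have L1 : 1 <= L by rewrite /L lerDr addr_ge0// ltW.
  by rewrite -[leLHS]mulr1 ler_pM// exprn_ege1.
have [mu0 mu0box mu0KL] := mixed_law (measurable_box r) (mass r r1) w01.
exists r, mu0; split; first exact: ltW.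
  apply: (le_trans mu0KL); rewrite lee_fin.
  have : w * (K' * r `^ alpha + C) <= 1.
    by rewrite /w mulrC ler_pdivrMr// mul1r.
  by lra.
move=> mu hmu renyi1.
have s0 : 0 < delta * r / 2 by rewrite divr_gt0// mulr_gt0.
have r0s : r0 <= delta * r / 2 by have : 0 <= `|K| by []; lra.
have := tail _ r0s mu renyi1.
have fs : (mu (far (delta * r - K)) <= mu (far (delta * r / 2)))%E.
  apply: le_measure; rewrite ?inE; try exact: measurable_far.
  move=> x; rewrite /far/=; apply: le_trans.
  by have := ler_norm K; lra.
have wle : ((2^-1)%:E * w%:E <= (2^-1)%:E * mu0 (box r))%E.
  by rewrite lee_wpmul2l// lee_fin.
move=> /(le_trans fs)/(le_trans hmu)/(le_trans wle).
rewrite -EFinM lee_fin leNgt => /negP; apply.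
have -> : delta ^+ 2 / (16 * L) / (delta * r / 2) ^+ 2 = 4^-1 * w.
  by rewrite /w; field; rewrite !gt_eqF.
have w0 : 0 < w by rewrite invr_gt0.
by lra.
Qed.

(** Each [k] is refuted by an initial law that depends on it, so the infimum is over the empty
    set. *)
Lemma lmc_complexity_pinfty (h Delta0 : R) : alpha = 2 -> 0 < h -> h < b^-1 ->
  2 <= Delta0 -> lmc_complexity (renyi q%:E) KL V pi h Delta0 1 = +oo%E.
Proof.
move=> a2 h0 hb D2; apply/eqP; rewrite -leye_eq.
apply: le_ereal_inf_tmp => _ [k hk <-]; exfalso.
have hb1 : h * b < 1 by rewrite -ltr_pdivlMr// mul1r.
have [delta [K [delta0 law]]] := lmc_law_linear d0 b0 gradV k a2 h0 hb1.
have [r [mu0 [r0 mu0KL far_mu]]] := KL_ball_unreachable K a2 delta0.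
have [|muk lawk renyi1] := hk mu0.
  by rewrite (le_trans mu0KL)// lee_fin.
by apply: (far_mu muk) renyi1; exact: law.
Qed.

Lemma langevin_complexity_pinfty (Delta0 : R) : alpha = 2 ->
  2 <= Delta0 -> langevin_complexity (renyi q%:E) KL V pi Delta0 1 = +oo%E.
Proof.
move=> a2 D2; apply/eqP; rewrite -leye_eq.
apply: le_ereal_inf_tmp => _ [t [t0 ht] <-]; exfalso.
have [delta [K [delta0 law]]] := langevin_law_linear d0 b0 gradV a2 t0.
have [r [mu0 [r0 mu0KL far_mu]]] := KL_ball_unreachable K a2 delta0.
have [|rhot lawt renyi1] := ht mu0.
  by rewrite (le_trans mu0KL)// lee_fin.
by apply: (far_mu rhot) renyi1; exact: law.
Qed.

(** The radius solves [K * r^alpha + C = Delta0]. The available exponent [e = (2 - alpha) / alpha]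
    exceeds the claimed one by [gam], and the spare factor [Delta0^gam] absorbs all constants. *)
Lemma lower_bound_alpha_lt2 : 0 < alpha < 2 -> exists Dstar : R,
  forall Delta0, Dstar <= Delta0 -> forall q' : \bar R, (1 <= q')%E ->
  let tau := d%:R `^ (1 - alpha / 2) * Delta0 `^ ((2 - alpha) ^+ 2 / (2 * alpha)) in
  (forall h : R, 0 < h ->
    ((tau / h)%:E <= lmc_complexity (renyi q%:E) (renyi q') V pi h Delta0 1)%E) /\
  (tau%:E <= langevin_complexity (renyi q%:E) (renyi q') V pi Delta0 1)%E.
Proof.
move=> /andP[a0 a2].
have [K [C [K0 mass]]] := box_mass_powR d0 b0 dV gibbsV gradV a0.
have [rho rho1 hrho] := complexity_ge.
have rho0 : 0 < rho by rewrite (lt_le_trans _ rho1).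
pose gam : R := (2 - alpha) / 2.
have gam0 : 0 < gam by rewrite divr_gt0// subr_gt0.
pose e : R := (2 - alpha) / alpha.
have e0 : 0 < e by rewrite divr_gt0// subr_gt0.
(* The total constant that the spare power has to beat. *)
pose A := d%:R `^ (1 - alpha / 2) * (2 * K) `^ e / kappa.
have K20 : 0 < 2 * K by rewrite mulr_gt0.
have A0 : 0 < A by rewrite divr_gt0// mulr_gt0// powR_gt0.
(* In order, the summands give [Delta0 / 2 <= Delta0 - C], [rho <= r], [A <= Delta0^gam] and
   positivity. *)
exists (2 * `|C| + 2 * K * rho `^ alpha + A `^ gam^-1 + 1) => Delta0 hD q' q'1 tau.
have C0 : 0 <= `|C| by [].
have Kr0 : 0 <= 2 * K * rho `^ alpha by rewrite mulr_ge0 ?powR_ge0// ltW.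
have Ag0 : 0 <= A `^ gam^-1 by exact: powR_ge0.
have D0 : 0 < Delta0 by lra.
have DC : Delta0 / 2 <= Delta0 - C by have := ler_norm C; lra.
have DC0 : 0 < Delta0 - C by lra.
pose r := ((Delta0 - C) / K) `^ alpha^-1.
have DCK0 : 0 <= (Delta0 - C) / K by rewrite divr_ge0// ltW.
have ra : r `^ alpha = (Delta0 - C) / K.
  by rewrite /r -powRrM mulVf ?gt_eqF// powRr1.
have DK : Delta0 / (2 * K) <= (Delta0 - C) / K.
  by rewrite invfM mulrA ler_pM2r ?invr_gt0.
have DK0 : 0 <= Delta0 / (2 * K) by rewrite divr_ge0// ltW.
have rrho : rho <= r.
  rewrite -[leLHS]powRr1 ?(ltW rho0)// -(mulfV (lt0r_neq0 a0)) powRrM.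
  apply: ge0_ler_powR => //.
  - by rewrite invr_ge0 ltW.
  - by rewrite nnegrE powR_ge0.
  apply: le_trans DK; rewrite ler_pdivlMr// mulrC; lra.
have r1 : 1 <= r by exact: le_trans rho1 rrho.
apply: (hrho r Delta0 tau) => //.
  have := mass r r1; rewrite ra mulrCA divff ?gt_eqF// mulr1.
  by rewrite subrK.
have re : (Delta0 / (2 * K)) `^ e <= r `^ (2 - alpha).
  rewrite /r -powRrM (mulrC alpha^-1); apply: ge0_ler_powR => //.
  exact: ltW.
apply: (@le_trans _ _ (kappa * (Delta0 / (2 * K)) `^ e)); last first.
  by apply: ler_wpM2l => //; exact: ltW.
have AD : A <= Delta0 `^ gam.
  rewrite -[leLHS]powRr1 ?(ltW A0)// -(mulVf (lt0r_neq0 gam0)) powRrM.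
  apply: ge0_ler_powR; rewrite ?nnegrE ?(ltW gam0) ?powR_ge0 ?(ltW D0)//.
  by lra.
have eE : e = gam + (2 - alpha) ^+ 2 / (2 * alpha).
  by rewrite /e /gam; field; rewrite gt_eqF.
rewrite powRM ?(ltW D0) ?invr_ge0 ?(ltW K20)// eE powRD; last first.
  by rewrite (gt_eqF D0)/= implybT.
rewrite -eE /tau.
set De := Delta0 `^ (_ / _).
have De0 : 0 <= De by exact: powR_ge0.
have Ke0 : 0 < (2 * K) `^ e by rewrite powR_gt0.
have -> : (2 * K)^-1 `^ e = ((2 * K) `^ e)^-1.
  by rewrite -powR_inv1 ?(ltW K20)// -powRrM mulN1r powRN.
rewrite (_ : kappa * _ = kappa / (2 * K) `^ e * Delta0 `^ gam * De); last by ring.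
apply: ler_wpM2r => //.
have -> : d%:R `^ (1 - alpha / 2) = kappa / (2 * K) `^ e * A.
  by rewrite /A; field; rewrite !gt_eqF.
by apply: ler_wpM2l => //; rewrite divr_ge0// ltW.
Qed.

Lemma lower_bound_alpha0 : alpha = 0 -> exists Dstar : R,
  forall Delta0, Dstar <= Delta0 -> forall q' : \bar R, (1 <= q')%E ->
  let nu : R := b - d%:R in
  (forall h : R, 0 < h ->
    ((d%:R / (nu * h) * expR (Delta0 / nu))%:E <=
     lmc_complexity (renyi q%:E) (renyi q') V pi h Delta0 1)%E) /\
  ((d%:R / nu * expR (Delta0 / nu))%:E <=
   langevin_complexity (renyi q%:E) (renyi q') V pi Delta0 1)%E.
Proof.
(* For [nu <= 0] the claimed bounds are nonpositive, with value 0 at [nu = 0] since the inverse of 0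
   is 0, while complexities are infima of nonnegative numbers. *)
move=> a0; have [nu0|nu0] := leP (b - d%:R) 0.
  exists 0 => Delta0 _ q' q'1 nu.
  have nuV : nu^-1 <= 0 by rewrite invr_le0.
  split.
    move=> h h0; apply: le_ereal_inf_tmp => _ [k _ <-]; rewrite lee_fin.
    apply: (@le_trans _ _ 0) => //.
    rewrite pmulr_lle0 ?expR_gt0// pmulr_rle0// invr_le0.
    by rewrite pmulr_lle0.
  apply: le_ereal_inf_tmp => _ [t [t0 _] <-]; rewrite lee_fin.
  apply: le_trans t0.
  by rewrite pmulr_lle0 ?expR_gt0// pmulr_rle0.
have [C mass] := box_mass_ln d0 b0 dV gibbsV gradV a0.
have [rho rho1 hrho] := complexity_ge.
have rho0 : 0 < rho by rewrite (lt_le_trans _ rho1).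
set nu := b - d%:R in nu0 mass *.
(* The target time equals [kappa * A * r], linear in [r], so [A <= r] brings it below
   [kappa * r ^+ 2]. *)
pose A := d%:R / nu * expR (C / nu) / kappa.
have A0 : 0 < A by rewrite !divr_gt0// mulr_gt0 ?divr_gt0// expR_gt0.
exists (C + nu * ln (rho + A)) => Delta0 hD q' q'1.
pose r := expR ((Delta0 - C) / nu).
have rA : rho + A <= r.
  rewrite -[leLHS]lnK ?posrE ?addr_gt0// ler_expR ler_pdivlMr// mulrC.
  by lra.
have rrho : rho <= r by lra.
have r1 : 1 <= r by lra.
have rgt0 : 0 < r by lra.
have E : expR (Delta0 / nu) = expR (C / nu) * r.
  by rewrite /r -expRD; congr expR; field; rewrite gt_eqF.
have [lmc ld] : (forall h : R, 0 < h ->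
    ((d%:R / nu * expR (Delta0 / nu) / h)%:E <=
     lmc_complexity (renyi q%:E) (renyi q') V pi h Delta0 1)%E) /\
  ((d%:R / nu * expR (Delta0 / nu))%:E <=
   langevin_complexity (renyi q%:E) (renyi q') V pi Delta0 1)%E.
  apply: (hrho r Delta0) => //.
    have := mass r r1; rewrite /r expRK mulrCA divff ?gt_eqF// mulr1.
    by rewrite subrK.
  rewrite a0 subr0 powR_mulrn ?(ltW rgt0)// E mulrA.
  have -> : d%:R / nu * expR (C / nu) = kappa * A.
    by rewrite /A; field; rewrite !gt_eqF.
  rewrite -mulrA; apply: ler_wpM2l; first exact: ltW.
  by rewrite expr2 ler_wpM2r ?(ltW rgt0)//; lra.
split => // h h0.
have -> : d%:R / (nu * h) * expR (Delta0 / nu) = d%:R / nu * expR (Delta0 / nu) / h.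
  by field; rewrite !gt_eqF.
exact: lmc.
Qed.

End complexity_bounds.

Theorem theorem10 (R : realType) (b alpha : R)
    (hb : 0 < b) (halpha : 0 <= alpha <= 2) :
  exists2 c : R, 0 < c &
  forall (d : nat) (V : 'rV[R]_d -> R) (pi : probability 'rV[R]_d R) (q : R),
    (0 < d)%N ->
    (forall x, differentiable V x) ->
    gibbs V pi ->
    1 < q ->
    (\int[pi]_x (enorm x `^ (2 * q / (q - 1)))%:E < +oo)%E ->
    (forall x, enorm (grad V x) <=
       b * enorm x / (1 + enorm x ^+ 2) `^ (1 - alpha / 2)) ->
    let nu : R := b - d%:R in
    exists Dstar : R, forall Delta0 : R, Dstar <= Delta0 ->
    [/\ alpha = 2 ->
          (forall h : R, 0 < h -> h < b^-1 ->
             ((c * (ln Delta0 / h))%:E <=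
              lmc_complexity (renyi q%:E) KL V pi h Delta0 1)%E) /\
          ((c * ln Delta0)%:E <=
             langevin_complexity (renyi q%:E) KL V pi Delta0 1)%E,
        0 < alpha < 2 -> forall q' : \bar R, (1 <= q')%E ->
          (forall h : R, 0 < h ->
             ((c * (d%:R `^ (1 - alpha / 2)
                    * Delta0 `^ ((2 - alpha) ^+ 2 / (2 * alpha)) / h))%:E <=
              lmc_complexity (renyi q%:E) (renyi q') V pi h Delta0 1)%E) /\
          ((c * (d%:R `^ (1 - alpha / 2)
                 * Delta0 `^ ((2 - alpha) ^+ 2 / (2 * alpha))))%:E <=
             langevin_complexity (renyi q%:E) (renyi q') V pi Delta0 1)%E
      & alpha = 0 -> forall q' : \bar R, (1 <= q')%E ->
          (forall h : R, 0 < h ->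
             ((c * (d%:R / (nu * h) * expR (Delta0 / nu)))%:E <=
              lmc_complexity (renyi q%:E) (renyi q') V pi h Delta0 1)%E) /\
          ((c * (d%:R / nu * expR (Delta0 / nu)))%:E <=
             langevin_complexity (renyi q%:E) (renyi q') V pi Delta0 1)%E].
Proof.
exists 1 => // d V pi q d0 dV gibbsV q1 moment gradV nu.
have [a2|an2] := eqVneq alpha 2.
  (* The KL budget of the initial laws built in [KL_ball_unreachable]. *)
  exists 2 => Delta0 hD; split.
  - move=> _; split => [h h0 hbV|].
      by rewrite (lmc_complexity_pinfty d0 hb dV gibbsV q1 moment gradV) ?leey.
    by rewrite (langevin_complexity_pinfty d0 hb dV gibbsV q1 moment gradV) ?leey.
  - by rewrite a2 ltxx andbF.
  - by rewrite a2 => /eqP; rewrite pnatr_eq0.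
have alt2 : alpha < 2 by case/andP: halpha; rewrite lt_neqAle an2.
have [a0|an0] := eqVneq alpha 0.
  have [Dstar hDstar] := lower_bound_alpha0 d0 hb halpha dV gibbsV q1 moment gradV a0.
  exists Dstar => Delta0 hD; split.
  - by move=> a2; move: alt2; rewrite a2 ltxx.
  - by rewrite a0 ltxx.
  - move=> _ q' q'1; have [lmc ld] := hDstar Delta0 hD q' q'1.
    by split => [h h0|]; rewrite mul1r; [exact: lmc|exact: ld].
have a02 : 0 < alpha < 2.
  by rewrite alt2 andbT lt_neqAle eq_sym an0; case/andP: halpha.
have [Dstar hDstar] :=
  lower_bound_alpha_lt2 d0 hb halpha dV gibbsV q1 moment gradV a02.
exists Dstar => Delta0 hD; split.
- by move=> a2; move: alt2; rewrite a2 ltxx.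
- move=> _ q' q'1; have [lmc ld] := hDstar Delta0 hD q' q'1.
  by split => [h h0|]; rewrite mul1r; [exact: lmc|exact: ld].
- by move=> a0; rewrite a0 eqxx in an0.
Qed.
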